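(* Let $\mathcal{A}$ be an abelian category with enough projectives, let $\mathcal{B}$ be an abelian category with enough injectives, and let $\mathrm{F}\colon\mathcal{A}\rightleftarrows\mathcal{B}\colon\mathrm{G}$ be an adjunction with $\mathrm{F}$ left adjoint of $\mathrm{G}$. For every integer $\ell$, the functors $\mathrm{L}_\ell\mathrm{F}$ and $\mathrm{R}^\ell\mathrm{G}$ restrict to functors $$\mathrm{L}_\ell\mathrm{F}\colon \mathsf{Fix}_\ell(\mathcal{A}) \longrightarrow \mathsf{coFix}_\ell(\mathcal{B}) \quad\text{and}\quad \mathrm{R}^\ell\mathrm{G}\colon \mathsf{coFix}_\ell(\mathcal{B}) \longrightarrow \mathsf{Fix}_\ell(\mathcal{A}),$$ and these constitute an adjoint equivalence of categories between the category $\mathsf{Fix}_\ell(\mathcal{A})$ of $\ell$-fixed objects in $\mathcal{A}$ and the category $\mathsf{coFix}_\ell(\mathcal{B})$ of $\ell$-cofixed objects in $\mathcal{B}$.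
   Context: Complexes are graded homologically; $(\Sigma^\ell X)_n = X_{n-\ell}$ with $\partial^{\Sigma^\ell X}_n = (-1)^\ell\partial^X_{n-\ell}$. $\mathsf{K}(-)$ denotes the homotopy category of complexes. $\mathrm{P}(A)$ denotes a projective resolution of $A\in\mathcal{A}$ (concentrated in degrees $\geq 0$) and $\mathrm{I}(B)$ an injective resolution of $B\in\mathcal{B}$ (concentrated in degrees $\leq 0$). The derived functors are $\mathrm{L}_i\mathrm{F}(A)=\mathrm{H}_i(\mathrm{F}(\mathrm{P}(A)))$ and $\mathrm{R}^i\mathrm{G}(B)=\mathrm{H}_{-i}(\mathrm{G}(\mathrm{I}(B)))$; they vanish for $i<0$. The maps $u$, $v$. A complex has homology concentrated in degree $\ell$ if $\mathrm{H}_i=0$ for all $i\neq\ell$. If $X$ is a complex in $\mathcal{A}$ with homology concentrated in degree $\ell$, then $\mathrm{H}_0(-)$ induces an isomorphism $\mathrm{Hom}_{\mathsf{K}(\mathcal{A})}(\mathrm{P}(A),\Sigma^{-\ell}X)\to\mathrm{Hom}_{\mathcal{A}}(A,\mathrm{H}_\ell(X))$, whose inverse is denoted $u^\ell_{A,X}$. If $Y$ is a complex in $\mathcal{B}$ with homology concentrated in degree $\ell$, then $\mathrm{H}_0(-)$ induces an isomorphism $\mathrm{Hom}_{\mathsf{K}(\mathcal{B})}(\Sigma^{-\ell}Y,\mathrm{I}(B))\to\mathrm{Hom}_{\mathcal{B}}(\mathrm{H}_\ell(Y),B)$, whose inverse is denoted $v^\ell_{Y,B}$. The map $h^\ell$.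 If $\mathrm{L}_i\mathrm{F}(A)=0$ and $\mathrm{R}^i\mathrm{G}(B)=0$ for all $i\neq\ell$, then $h^\ell_{A,B}\colon\mathrm{Hom}_{\mathcal{B}}(\mathrm{L}_\ell\mathrm{F}(A),B)\to\mathrm{Hom}_{\mathcal{A}}(A,\mathrm{R}^\ell\mathrm{G}(B))$ is the composite of the following isomorphisms: $v^\ell_{\mathrm{F}(\mathrm{P}(A)),B}$ onto $\mathrm{Hom}_{\mathsf{K}(\mathcal{B})}(\Sigma^{-\ell}\mathrm{F}(\mathrm{P}(A)),\mathrm{I}(B))$; then $\Sigma^\ell(-)$ onto $\mathrm{Hom}_{\mathsf{K}(\mathcal{B})}(\mathrm{F}(\mathrm{P}(A)),\Sigma^\ell\mathrm{I}(B))$; then the adjunction isomorphism (degreewise application of $(\mathrm{F},\mathrm{G})$) onto $\mathrm{Hom}_{\mathsf{K}(\mathcal{A})}(\mathrm{P}(A),\mathrm{G}(\Sigma^\ell\mathrm{I}(B)))=\mathrm{Hom}_{\mathsf{K}(\mathcal{A})}(\mathrm{P}(A),\Sigma^\ell\mathrm{G}(\mathrm{I}(B)))$; then $(u^{-\ell}_{A,\mathrm{G}(\mathrm{I}(B))})^{-1}$ onto $\mathrm{Hom}_{\mathcal{A}}(A,\mathrm{R}^\ell\mathrm{G}(B))$. The maps $\eta^\ell$, $\varepsilon^\ell$. If $\mathrm{L}_i\mathrm{F}(A)=0=\mathrm{R}^i\mathrm{G}(\mathrm{L}_\ell\mathrm{F}(A))$ for all $i\neq\ell$, put $\eta^\ell_A=h^\ell_{A,\mathrm{L}_\ell\mathrm{F}(A)}(1_{\mathrm{L}_\ell\mathrm{F}(A)})\colon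 A\to\mathrm{R}^\ell\mathrm{G}(\mathrm{L}_\ell\mathrm{F}(A))$. If $\mathrm{R}^i\mathrm{G}(B)=0=\mathrm{L}_i\mathrm{F}(\mathrm{R}^\ell\mathrm{G}(B))$ for all $i\neq\ell$, put $\varepsilon^\ell_B=(h^\ell_{\mathrm{R}^\ell\mathrm{G}(B),B})^{-1}(1_{\mathrm{R}^\ell\mathrm{G}(B)})\colon\mathrm{L}_\ell\mathrm{F}(\mathrm{R}^\ell\mathrm{G}(B))\to B$. (For $\ell=0$ these are the unit and counit of $(\mathrm{F},\mathrm{G})$.) Fixed and cofixed objects. $\mathsf{Fix}_\ell(\mathcal{A})$ is the full subcategory of $\mathcal{A}$ whose objects $A$ (called $\ell$-fixed) satisfy: (i) $\mathrm{L}_i\mathrm{F}(A)=0$ for all $i\neq\ell$; (ii) $\mathrm{R}^i\mathrm{G}(\mathrm{L}_\ell\mathrm{F}(A))=0$ for all $i\neq\ell$; (iii) $\eta^\ell_A$ is an isomorphism. $\mathsf{coFix}_\ell(\mathcal{B})$ is the full subcategory of $\mathcal{B}$ whose objects $B$ (called $\ell$-cofixed) satisfy: (i$'$) $\mathrm{R}^i\mathrm{G}(B)=0$ for all $i\neq\ell$; (ii$'$) $\mathrm{L}_i\mathrm{F}(\mathrm{R}^\ell\mathrm{G}(B))=0$ for all $i\neq\ell$; (iii$'$) $\varepsilon^\ell_B$ is an isomorphism. *)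

(* Defs.v *)
From HB Require Import structures.
From mathcomp Require Import all_boot all_order all_algebra.
From mathcomp Require Import generic_quotient.
From mathcomp Require Import boolp classical_sets.

Set Implicit Arguments.
Unset Strict Implicit.
Unset Printing Implicit Defensive.

Import GRing.Theory.
Local Open Scope ring_scope.
Local Open Scope quotient_scope.

Record preadditive := Preadditive {
  obj :> Type;
  hom : obj -> obj -> zmodType;
  idm : forall X, hom X X;
  cmp : forall X Y Z, hom Y Z -> hom X Y -> hom X Z;
  cmpA : forall W X Y Z (h : hom Y Z) (g : hom X Y) (f : hom W X),
    cmp h (cmp g f) = cmp (cmp h g) f;
  cmp1m : forall X Y (f : hom X Y), cmp (idm Y) f = f;
  cmpm1 : forall X Y (f : hom X Y), cmp f (idm X) = f;
  cmpDl : forall X Y Z (g g' : hom Y Z) (f : hom X Y),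
    cmp (g + g') f = cmp g f + cmp g' f;
  cmpDr : forall X Y Z (g : hom Y Z) (f f' : hom X Y),
    cmp g (f + f') = cmp g f + cmp g f' }.

Arguments hom {p} X Y.
Arguments idm {p} X.
Arguments cmp {p X Y Z} g f.

Notation "g '\co' f" := (cmp g f) (at level 40, left associativity).

Section CategoryNotions.
Variable C : preadditive.
Implicit Types X Y Z : C.

Definition is_zero Z :=
  (forall X (f : hom X Z), f = 0) /\ (forall X (f : hom Z X), f = 0).

Definition mono X Y (m : hom X Y) :=
  forall T (a b : hom T X), m \co a = m \co b -> a = b.

Definition epi X Y (e : hom X Y) :=
  forall T (a b : hom Y T), a \co e = b \co e -> a = b.

Definition is_iso X Y (f : hom X Y) :=
  exists g : hom Y X, g \co f = idm X /\ f \co g = idm Y.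

Definition is_kernel X Y (f : hom X Y) K (k : hom K X) :=
  f \co k = 0 /\
  forall T (g : hom T X), f \co g = 0 -> exists! u : hom T K, k \co u = g.

Definition is_cokernel X Y (f : hom X Y) Q (q : hom Y Q) :=
  q \co f = 0 /\
  forall T (g : hom Y T), g \co f = 0 -> exists! u : hom Q T, u \co q = g.

Definition is_biproduct X Y S (i1 : hom X S) (i2 : hom Y S)
    (p1 : hom S X) (p2 : hom S Y) :=
  [/\ p1 \co i1 = idm X, p2 \co i2 = idm Y, p2 \co i1 = 0, p1 \co i2 = 0
    & i1 \co p1 + i2 \co p2 = idm S].

Record is_abelian : Prop := IsAbelian {
  has_zero_object : exists Z, is_zero Z;
  has_biproducts : forall X Y, exists S (i1 : hom X S) (i2 : hom Y S)
    (p1 : hom S X) (p2 : hom S Y), is_biproduct i1 i2 p1 p2;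
  has_kernels : forall X Y (f : hom X Y), exists K (k : hom K X),
    is_kernel f k;
  has_cokernels : forall X Y (f : hom X Y), exists Q (q : hom Y Q),
    is_cokernel f q;
  mono_normal : forall X Y (m : hom X Y), mono m ->
    exists Z (f : hom Y Z), is_kernel f m;
  epi_normal : forall X Y (e : hom X Y), epi e ->
    exists Z (f : hom Z X), is_cokernel f e }.

Definition is_projective X :=
  forall Y Z (e : hom Y Z) (f : hom X Z), epi e ->
    exists g : hom X Y, e \co g = f.

Definition is_injective X :=
  forall Y Z (m : hom Y Z) (f : hom Y X), mono m ->
    exists g : hom Z X, g \co m = f.

Definition enough_projectives :=
  forall X, exists P (e : hom P X), is_projective P /\ epi e.

Definition enough_injectives :=
  forall X, exists I (m : hom X I), is_injective I /\ mono m.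

Record iso X Y := Iso {
  iso_hom :> hom X Y;
  iso_inv : hom Y X;
  iso_homK : iso_inv \co iso_hom = idm X;
  iso_invK : iso_hom \co iso_inv = idm Y }.

Lemma cmp0m X Y Z (f : hom X Y) : (0 : hom Y Z) \co f = 0.
Proof. by apply: (@addrI _ (0 \co f)); rewrite -cmpDl !addr0. Qed.

Lemma cmpm0 X Y Z (g : hom Y Z) : g \co (0 : hom X Y) = 0.
Proof. by apply: (@addrI _ (g \co 0)); rewrite -cmpDr !addr0. Qed.

Lemma cmpNm X Y Z (g : hom Y Z) (f : hom X Y) : - g \co f = - (g \co f).
Proof. by apply: (@addrI _ (g \co f)); rewrite -cmpDl !subrr cmp0m. Qed.

Lemma cmpmN X Y Z (g : hom Y Z) (f : hom X Y) : g \co - f = - (g \co f).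
Proof. by apply: (@addrI _ (g \co f)); rewrite -cmpDr !subrr cmpm0. Qed.

End CategoryNotions.

Arguments has_zero_object {C}.
Arguments enough_projectives : clear implicits.
Arguments enough_injectives : clear implicits.

Lemma additive_mulrz (U V : zmodType) (f : U -> V) :
  {morph f : x y / x + y} -> forall x n, f (x *~ n) = f x *~ n.
Proof.
move=> fD x n.
have f0 : f 0 = 0 by apply: (@addrI _ (f 0)); rewrite -fD !addr0.
have fMn y k : f (y *+ k) = f y *+ k.
  by elim: k => [|k IHk]; rewrite ?mulr0n // !mulrS fD IHk.
have fN y : f (- y) = - f y.
  by apply: (@addrI _ (f y)); rewrite -fD !subrr.
by case: n => n; rewrite ?NegzE ?mulrNz ?fN -!pmulrn fMn.
Qed.

Lemma cmpMzl (C : preadditive) (X Y Z : C) (g : hom Y Z) (f : hom X Y) n :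
  g *~ n \co f = (g \co f) *~ n.
Proof.
exact: (additive_mulrz (f := fun g => g \co f)) (fun a b => cmpDl a b f) g n.
Qed.

Lemma cmpMzr (C : preadditive) (X Y Z : C) (g : hom Y Z) (f : hom X Y) n :
  g \co (f *~ n) = (g \co f) *~ n.
Proof. exact: (additive_mulrz (f := cmp g)) (cmpDr g) f n. Qed.

Record abelian := Abelian {
  abelian_cat :> preadditive;
  abelianP : is_abelian abelian_cat }.

Record functor_data (C D : preadditive) := FunctorData {
  fobj :> C -> D;
  fmap : forall X Y : C, hom X Y -> hom (fobj X) (fobj Y) }.

Arguments fmap {C D} f {X Y} _.

Record is_functor (C D : preadditive) (F : functor_data C D) : Prop :=
  IsFunctor {
    fmap_id : forall X : C, fmap F (idm X) = idm (F X);
    fmap_cmp : forall (X Y Z : C) (g : hom Y Z) (f : hom X Y),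
      fmap F (g \co f) = fmap F g \co fmap F f }.

Record functor (C D : preadditive) := Functor {
  functor_fd :> functor_data C D;
  functorP : is_functor functor_fd }.

Record additive_functor (C D : preadditive) := AdditiveFunctor {
  additive_fun :> functor C D;
  fmapD : forall (X Y : C) (f g : hom X Y),
    fmap additive_fun (f + g) = fmap additive_fun f + fmap additive_fun g }.

Record adjunction (C D : preadditive) (F : functor C D) (G : functor D C) :=
  Adjunction {
    adj : forall (X : C) (Y : D), hom (F X) Y -> hom X (G Y);
    adj_inv : forall (X : C) (Y : D), hom X (G Y) -> hom (F X) Y;
    adjK : forall (X : C) (Y : D), cancel (@adj X Y) (@adj_inv X Y);
    adj_invK : forall (X : C) (Y : D), cancel (@adj_inv X Y) (@adj X Y);
    adj_nat : forall (X X' : C) (Y Y' : D)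
      (g : hom Y Y') (f : hom (F X) Y) (h : hom X' X),
      adj (g \co f \co fmap F h) = fmap G g \co adj f \co h }.

Arguments adj {C D F G} _ {X Y} _.
Arguments adj_inv {C D F G} _ {X Y} _.
Arguments adjK {C D F G} _ {X Y}.
Arguments adj_invK {C D F G} _ {X Y}.

Definition full_sub (C : preadditive) (P : C -> Prop) : preadditive :=
  @Preadditive {X : C | P X} (fun X Y => hom (sval X) (sval Y))
    (fun X => idm (sval X)) (fun _ _ _ g f => g \co f)
    (fun _ _ _ _ => @cmpA C _ _ _ _) (fun _ _ => @cmp1m C _ _)
    (fun _ _ => @cmpm1 C _ _) (fun _ _ _ => @cmpDl C _ _ _)
    (fun _ _ _ => @cmpDr C _ _ _).

Definition restrict (C D : preadditive) (P : C -> Prop) (Q : D -> Prop)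
    (F : functor_data C D) (FPQ : forall X, P X -> Q (F X)) :
    functor_data (full_sub P) (full_sub Q) :=
  @FunctorData (full_sub P) (full_sub Q)
    (fun X => exist Q (F (sval X)) (FPQ _ (svalP X)))
    (fun X Y (f : hom (sval X) (sval Y)) => fmap F f).

Definition adjoint_equivalence (C D : preadditive)
    (L : functor C D) (R : functor D C) :=
  exists (unit : forall X : C, hom X (R (L X)))
         (counit : forall Y : D, hom (L (R Y)) Y),
  [/\ (forall (X X' : C) (f : hom X X'),
         unit X' \co f = fmap R (fmap L f) \co unit X),
      (forall (Y Y' : D) (g : hom Y Y'),
         g \co counit Y = counit Y' \co fmap L (fmap R g)),
      (forall X, is_iso (unit X)) /\ (forall Y, is_iso (counit Y)),
      (forall X, counit (L X) \co fmap L (unit X) = idm (L X))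
    & (forall Y, fmap R (counit Y) \co unit (R Y) = idm (R Y))].

Section AdjointAdditive.
Variables (A B : abelian) (F : functor A B) (G : functor B A).
Variable FG : adjunction F G.

Lemma adj_natl (X X' : A) (Y : B) (f : hom (F X) Y) (h : hom X' X) :
  adj FG (f \co fmap F h) = adj FG f \co h.
Proof.
have := adj_nat FG (idm Y) f h.
by rewrite !cmp1m (fmap_id (functorP G)) cmp1m.
Qed.

Lemma adj_natr (X : A) (Y Y' : B) (g : hom Y Y') (f : hom (F X) Y) :
  adj FG (g \co f) = fmap G g \co adj FG f.
Proof.
have := adj_nat FG g f (idm X).
by rewrite (fmap_id (functorP F)) !cmpm1.
Qed.

Lemma left_adjoint0 (X Y : A) : fmap F (0 : hom X Y) = 0.
Proof.
have [Z [Zt Zi]] := has_zero_object (abelianP A).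
have FZ : idm (F Z) = 0.
  apply: (can_inj (adjK FG)).
  by rewrite (Zi _ (adj FG (idm (F Z)))) (Zi _ (adj FG 0)).
rewrite -(cmp0m Y (0 : hom X Z)) (fmap_cmp (functorP F)).
by rewrite -(cmpm1 (fmap F (0 : hom Z Y))) FZ cmpm0 cmp0m.
Qed.

Lemma left_adjointD (X Y : A) (f g : hom X Y) :
  fmap F (f + g) = fmap F f + fmap F g.
Proof.
have [S [i1 [i2 [p1 [p2 [p1i1 p2i2 p2i1 p1i2 i1p1i2p2]]]]]] :=
  has_biproducts (abelianP A) X X.
have FM := fmap_cmp (functorP F); have F1 := fmap_id (functorP F).
have jepi (T : B) (a b : hom (F S) T) :
    a \co fmap F i1 = b \co fmap F i1 -> a \co fmap F i2 = b \co fmap F i2 ->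
    a = b.
  move=> e1 e2; apply: (can_inj (adjK FG)).
  rewrite -(cmpm1 (adj FG a)) -(cmpm1 (adj FG b)) -i1p1i2p2 !cmpDr !cmpA.
  by rewrite -!adj_natl e1 e2.
have FS : fmap F i1 \co fmap F p1 + fmap F i2 \co fmap F p2 = idm (F S).
  apply: jepi; rewrite cmpDl -!cmpA -!FM.
    by rewrite p1i1 p2i1 cmpm1 cmpm0 left_adjoint0 addr0 cmp1m.
  by rewrite p1i2 p2i2 cmpm1 cmpm0 left_adjoint0 add0r cmp1m.
pose s := f \co p1 + g \co p2; pose d := i1 + i2.
have si1 : s \co i1 = f by rewrite cmpDl -!cmpA p1i1 p2i1 cmpm0 cmpm1 addr0.
have si2 : s \co i2 = g by rewrite cmpDl -!cmpA p1i2 p2i2 cmpm0 cmpm1 add0r.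
have p1d : p1 \co d = idm X by rewrite cmpDr p1i1 p1i2 addr0.
have p2d : p2 \co d = idm X by rewrite cmpDr p2i1 p2i2 add0r.
have -> : f + g = s \co d by rewrite cmpDr si1 si2.
rewrite FM -(cmpm1 (fmap F s)) -FS cmpDr cmpDl !cmpA -!FM si1 si2 -!cmpA.
by rewrite p1d p2d !cmpm1.
Qed.

Definition left_adjoint : additive_functor A B :=
  AdditiveFunctor left_adjointD.

Lemma adj_inv_natl (X X' : A) (Y : B) (f : hom X (G Y)) (h : hom X' X) :
  adj_inv FG (f \co h) = adj_inv FG f \co fmap F h.
Proof. by apply: (can_inj (adjK FG)); rewrite adj_natl !adj_invK. Qed.

Lemma adj_invD (X : A) (Y : B) (f g : hom X (G Y)) :
  adj_inv FG (f + g) = adj_inv FG f + adj_inv FG g.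
Proof.
rewrite -{1}(cmp1m f) -{1}(cmp1m g) -cmpDr adj_inv_natl left_adjointD cmpDr.
by rewrite -!adj_inv_natl !cmp1m.
Qed.

Lemma adjD (X : A) (Y : B) (f g : hom (F X) Y) :
  adj FG (f + g) = adj FG f + adj FG g.
Proof. by apply: (can_inj (adj_invK FG)); rewrite adj_invD !adjK. Qed.

Lemma right_adjointD (X Y : B) (f g : hom X Y) :
  fmap G (f + g) = fmap G f + fmap G g.
Proof.
have E (k : hom X Y) : fmap G k = adj FG (k \co adj_inv FG (idm (G X))).
  by rewrite adj_natr adj_invK cmpm1.
by rewrite !E cmpDl adjD.
Qed.

Definition right_adjoint : additive_functor B A :=
  AdditiveFunctor right_adjointD.

End AdjointAdditive.

Lemma fmap0 (C D : preadditive) (F : additive_functor C D) (X Y : C) :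
  fmap F (0 : hom X Y) = 0.
Proof. by apply: (@addrI _ (fmap F 0)); rewrite -fmapD !addr0. Qed.

(* The differential X_n -> X_(n-1) is [diff X n (n - 1)]; indexing it by
   source and target avoids casts, and the components with other indices are
   forced to vanish. *)
Record complex (C : preadditive) := Complex {
  cpx :> int -> C;
  diff : forall i j, hom (cpx i) (cpx j);
  diff_shape : forall i j, i != j + 1 -> diff i j = 0;
  diffK : forall i j k, diff j k \co diff i j = 0 }.

Arguments diff {C} _ i j.

Record chain_map (C : preadditive) (X Y : complex C) := ChainMap {
  cmap :> forall n, hom (X n) (Y n);
  cmap_diff : forall i j, diff Y i j \co cmap i = cmap j \co diff X i j }.

HB.instance Definition _ (C : preadditive) (X Y : complex C) :=
  gen_eqMixin (chain_map X Y).
HB.instance Definition _ (C : preadditive) (X Y : complex C) :=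
  gen_choiceMixin (chain_map X Y).

Section Homotopy.
Variables (C : preadditive) (X Y : complex C).

(* Only the components s_n : X_n -> Y_(n+1) of s are used. *)
Definition homotopic (f g : chain_map X Y) :=
  exists s : forall i j, hom (X i) (Y j), forall n,
    f n - g n =
    diff Y (n + 1) n \co s n (n + 1) + s (n - 1) n \co diff X n (n - 1).

Definition homotopicb (f g : chain_map X Y) : bool := `[< homotopic f g >].

Lemma homotopicb_refl : reflexive homotopicb.
Proof.
move=> f; apply/asboolP; exists (fun _ _ => 0) => n.
by rewrite cmp0m cmpm0 subrr addr0.
Qed.

Lemma homotopicb_sym : symmetric homotopicb.
Proof.
suff H f g : homotopicb f g -> homotopicb g f by move=> f g; apply/idP/idP=> /H.
move=> /asboolP[s sE]; apply/asboolP; exists (fun i j => - s i j) => n.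
by rewrite cmpmN cmpNm -opprD -sE opprB.
Qed.

Lemma homotopicb_trans : transitive homotopicb.
Proof.
move=> g f h /asboolP[s sE] /asboolP[t tE]; apply/asboolP.
exists (fun i j => s i j + t i j) => n.
by rewrite cmpDr cmpDl addrACA -sE -tE addrA subrK.
Qed.

Canonical homotopic_equiv :=
  EquivRel homotopicb homotopicb_refl homotopicb_sym homotopicb_trans.

Definition homK := {eq_quot homotopic_equiv}.

Lemma homKP (f g : chain_map X Y) :
  \pi_homK f = \pi_homK g <-> homotopic f g.
Proof.
split=> [/eqmodP/asboolP //|fg]; apply/eqmodP; exact/asboolP.
Qed.

Lemma zero_chain_subproof i j :
  diff Y i j \co (0 : hom (X i) (Y i)) = 0 \co diff X i j.
Proof. by rewrite cmpm0 cmp0m. Qed.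

Definition zero_chain : chain_map X Y := ChainMap zero_chain_subproof.

End Homotopy.

Section HomotopyCategory.
Variables (C : preadditive) (X Y Z : complex C).

Lemma cmp_chain_subproof (g : chain_map Y Z) (f : chain_map X Y) i j :
  diff Z i j \co (g i \co f i) = g j \co f j \co diff X i j.
Proof. by rewrite cmpA cmap_diff -!cmpA cmap_diff. Qed.

Definition cmp_chain (g : chain_map Y Z) (f : chain_map X Y) :
  chain_map X Z := ChainMap (cmp_chain_subproof g f).

Definition cmpK (b : homK Y Z) (a : homK X Y) : homK X Z :=
  \pi_(homK _ _) (cmp_chain (repr b) (repr a)).

Lemma cmpK_pi (g : chain_map Y Z) (f : chain_map X Y) :
  cmpK (\pi_(homK _ _) g) (\pi_(homK _ _) f) = \pi_(homK _ _) (cmp_chain g f).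
Proof.
apply/homKP.
have /homKP[s sE] : \pi_(homK _ _) (repr (\pi_(homK _ _) g)) = \pi_(homK _ _) g.
  exact: reprK.
have /homKP[t tE] : \pi_(homK _ _) (repr (\pi_(homK _ _) f)) = \pi_(homK _ _) f.
  exact: reprK.
set g' := repr _ in sE *; set f' := repr _ in tE *.
exists (fun i j => s i j \co f' i + g j \co t i j) => n /=.
have -> : g' n \co f' n - g n \co f n =
          (g' n - g n) \co f' n + g n \co (f' n - f n).
  by rewrite cmpDl cmpDr cmpNm cmpmN addrA subrK.
rewrite sE tE !cmpDl !cmpDr !cmpA addrACA -!cmpA cmap_diff !cmpA.
by rewrite (cmap_diff g).
Qed.

End HomotopyCategory.

Section MapComplex.
Variables (C D : preadditive) (F : additive_functor C D).

Lemma map_diff_shape (X : complex C) i j :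
  i != j + 1 -> fmap F (diff X i j) = 0.
Proof. by move=> ij; rewrite diff_shape ?fmap0. Qed.

Lemma map_diffK (X : complex C) i j k :
  fmap F (diff X j k) \co fmap F (diff X i j) = 0.
Proof. by rewrite -(fmap_cmp (functorP F)) diffK fmap0. Qed.

Definition map_complex (X : complex C) : complex D :=
  Complex (@map_diff_shape X) (@map_diffK X).

Lemma map_chain_subproof (X Y : complex C) (f : chain_map X Y) i j :
  fmap F (diff Y i j) \co fmap F (f i) = fmap F (f j) \co fmap F (diff X i j).
Proof. by rewrite -!(fmap_cmp (functorP F)) cmap_diff. Qed.

Definition map_chain (X Y : complex C) (f : chain_map X Y) :
    chain_map (map_complex X) (map_complex Y) :=
  @ChainMap _ (map_complex X) (map_complex Y) _ (map_chain_subproof f).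

Definition mapK (X Y : complex C) (a : homK X Y) :
    homK (map_complex X) (map_complex Y) :=
  \pi_(homK _ _) (map_chain (repr a)).

Lemma mapK_pi (X Y : complex C) (f : chain_map X Y) :
  mapK (\pi_(homK _ _) f) = \pi_(homK _ _) (map_chain f).
Proof.
apply/homKP.
have /homKP[s sE] : \pi_(homK _ _) (repr (\pi_(homK _ _) f)) = \pi_(homK _ _) f.
  exact: reprK.
exists (fun i j => fmap F (s i j)) => n /=.
have FN (U V : C) (g : hom U V) : fmap F (- g) = - fmap F g.
  by apply: (@addrI _ (fmap F g)); rewrite -fmapD !subrr fmap0.
by rewrite -FN -fmapD sE fmapD !(fmap_cmp (functorP F)).
Qed.

End MapComplex.

Section Shift.
Variable C : preadditive.

(* The identity of X_i = X_j, for propositionally equal degrees. *)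
Definition eq_hom (X : complex C) i j (e : i = j) : hom (X i) (X j) :=
  ecast k (hom (X i) (X k)) e (idm (X i)).

Variable l : int.

Lemma shift_diff_shape (X : complex C) i j :
  i != j + 1 -> diff X (i - l) (j - l) *~ (-1) ^ l = 0.
Proof.
move=> ij; rewrite diff_shape ?mul0rz //.
by apply: contra ij; rewrite addrAC => /eqP/addIr->.
Qed.

Lemma shift_diffK (X : complex C) i j k :
  diff X (j - l) (k - l) *~ (-1) ^ l \co
  (diff X (i - l) (j - l) *~ (-1) ^ l) = 0.
Proof. by rewrite cmpMzl cmpMzr diffK !mul0rz. Qed.

Definition shift (X : complex C) : complex C :=
  @Complex C (fun n => X (n - l)) _
    (@shift_diff_shape X) (@shift_diffK X).

Lemma shift_chain_subproof (X Y : complex C) (f : chain_map X Y) i j :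
  diff (shift Y) i j \co f (i - l) = f (j - l) \co diff (shift X) i j.
Proof. by rewrite /= cmpMzl cmpMzr cmap_diff. Qed.

Definition shift_chain (X Y : complex C) (f : chain_map X Y) :
    chain_map (shift X) (shift Y) :=
  @ChainMap _ (shift X) (shift Y) _ (shift_chain_subproof f).

Definition shiftK (X Y : complex C) (a : homK X Y) :
    homK (shift X) (shift Y) :=
  \pi_(homK _ _) (shift_chain (repr a)).

Lemma shiftK_pi (X Y : complex C) (f : chain_map X Y) :
  shiftK (\pi_(homK _ _) f) = \pi_(homK _ _) (shift_chain f).
Proof.
apply/homKP.
have /homKP[s sE] : \pi_(homK _ _) (repr (\pi_(homK _ _) f)) = \pi_(homK _ _) f.
  exact: reprK.
exists (fun i j => s (i - l) (j - l) *~ (-1) ^ l) => n /=.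
rewrite !cmpMzl !cmpMzr -!mulrzA -exprzMl ?unitrN1 // mulrNN mulr1 exp1rz.
by rewrite !mulr1z sE !(addrAC n _ (- l)).
Qed.

End Shift.

Section ShiftShift.
Variables (C : preadditive) (l : int) (X : complex C).

Lemma eq_hom_diff i j i' j' (ei : i = i') (ej : j = j') :
  diff X i' j' \co eq_hom X ei = eq_hom X ej \co diff X i j.
Proof. by case: i' / ei; case: j' / ej; rewrite /eq_hom /= cmpm1 cmp1m. Qed.

Lemma shift_shift_deg n : n = n - l - - l.
Proof. by rewrite opprK subrK. Qed.

Lemma shift_shift_subproof i j :
  diff (shift l (shift (- l) X)) i j \co eq_hom X (shift_shift_deg i) =
  eq_hom X (shift_shift_deg j) \co diff X i j.
Proof.
rewrite /= -mulrzA -exprzDr ?unitrN1 // addNr expr0z mulr1z.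
exact: eq_hom_diff.
Qed.

(* The identification X = Sigma^l Sigma^-l X. *)
Definition shift_shift : chain_map X (shift l (shift (- l) X)) :=
  @ChainMap _ X (shift l (shift (- l) X)) _ shift_shift_subproof.

End ShiftShift.

Section Homology.
Variable C : abelian.

Section KernelCokernel.
Variables (X Y : C) (f : hom X Y).

Definition ker : C := projT1 (cid (has_kernels (abelianP C) f)).
Definition ker_in : hom ker X :=
  projT1 (cid (projT2 (cid (has_kernels (abelianP C) f)))).
Lemma kerP : is_kernel f ker_in.
Proof. exact: projT2 (cid (projT2 (cid (has_kernels (abelianP C) f)))). Qed.

Definition coker : C := projT1 (cid (has_cokernels (abelianP C) f)).
Definition coker_pr : hom Y coker :=
  projT1 (cid (projT2 (cid (has_cokernels (abelianP C) f)))).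
Lemma cokerP : is_cokernel f coker_pr.
Proof. exact: projT2 (cid (projT2 (cid (has_cokernels (abelianP C) f)))). Qed.

Lemma ker_lift_ex T (g : hom T X) : f \co g = 0 ->
  exists u : hom T ker, ker_in \co u = g.
Proof. by move=> /(kerP.2)[u [uE _]]; exists u. Qed.

Definition ker_lift T (g : hom T X) (g0 : f \co g = 0) : hom T ker :=
  projT1 (cid (ker_lift_ex g0)).

Lemma ker_liftE T (g : hom T X) (g0 : f \co g = 0) :
  ker_in \co ker_lift g0 = g.
Proof. exact: projT2 (cid (ker_lift_ex g0)). Qed.

Lemma ker_in_mono : mono ker_in.
Proof.
move=> T a b ab.
have /(kerP.2)[u [_ uU]] : f \co (ker_in \co b) = 0.
  by rewrite cmpA kerP.1 cmp0m.
by rewrite -(uU _ ab); apply: uU.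
Qed.

Lemma coker_pr_epi : epi coker_pr.
Proof.
move=> T a b ab.
have /(cokerP.2)[u [_ uU]] : (b \co coker_pr) \co f = 0.
  by rewrite -cmpA cokerP.1 cmpm0.
by rewrite -(uU _ ab); apply: uU.
Qed.

End KernelCokernel.

Definition cycles (X : complex C) n : C := ker (diff X n (n - 1)).

Definition boundary (X : complex C) n : hom (X (n + 1)) (cycles X n) :=
  ker_lift (diffK X (n + 1) n (n - 1)).

Definition homology (X : complex C) n : C := coker (boundary X n).

Section InducedMap.
Variables (X Y : complex C) (m n : int) (f : hom (X m) (Y n)).

Definition induces (h : hom (homology X m) (homology Y n)) :=
  exists z : hom (cycles X m) (cycles Y n),
    ker_in (diff Y n (n - 1)) \co z = f \co ker_in (diff X m (m - 1)) /\
    h \co coker_pr (boundary X m) = coker_pr (boundary Y n) \co z.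

(* The map H_m(X) -> H_n(Y) induced by f : X_m -> Y_n, when f is compatible
   with the differentials; see [homology_mapP]. *)
Definition homology_map : hom (homology X m) (homology Y n) :=
  xget 0 [set h | induces h].

Lemma induces_unique h h' : induces h -> induces h' -> h = h'.
Proof.
move=> [z [zE hE]] [z' [z'E h'E]]; apply: (@coker_pr_epi _ _ (boundary X m)).
by rewrite hE h'E; congr cmp; apply: (@ker_in_mono _ _ _ _); rewrite zE z'E.
Qed.

Lemma homology_mapP (fp : hom (X (m + 1)) (Y (n + 1)))
    (fm : hom (X (m - 1)) (Y (n - 1))) :
  diff Y (n + 1) n \co fp = f \co diff X (m + 1) m ->
  diff Y n (n - 1) \co f = fm \co diff X m (m - 1) ->
  induces homology_map.
Proof.
move=> fpE fmE; apply: xgetPex.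
have z0 : diff Y n (n - 1) \co (f \co ker_in (diff X m (m - 1))) = 0.
  by rewrite cmpA fmE -cmpA (kerP _).1 cmpm0.
have h0 : coker_pr (boundary Y n) \co ker_lift z0 \co boundary X m = 0.
  suff -> : coker_pr (boundary Y n) \co ker_lift z0 \co boundary X m =
            coker_pr (boundary Y n) \co boundary Y n \co fp.
    by rewrite (cokerP _).1 cmp0m.
  rewrite -!cmpA; congr cmp; apply: (@ker_in_mono _ _ _ _).
  by rewrite !cmpA !ker_liftE -cmpA ker_liftE fpE.
have [h [hE _]] := (cokerP (boundary X m)).2 _ _ h0.
by exists h; exists (ker_lift z0); rewrite ker_liftE.
Qed.

End InducedMap.

Definition homologyK (X Y : complex C) n (a : homK X Y) :
    hom (homology X n) (homology Y n) :=
  homology_map (repr a n).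

Lemma chain_map_induces (X Y : complex C) (f : chain_map X Y) n :
  induces (f n) (homology_map (f n)).
Proof. by apply: homology_mapP; apply: cmap_diff. Qed.

Lemma homologyK_pi (X Y : complex C) n (f : chain_map X Y) :
  homologyK n (\pi_(homK _ _) f) = homology_map (f n).
Proof.
set g := repr (\pi_(homK X Y) f).
have /homKP[s sE] : \pi_(homK X Y) g = \pi_(homK _ _) f by exact: reprK.
apply: (@induces_unique _ _ _ _ (f n)); last exact: chain_map_induces.
have [z [zE hE]] := chain_map_induces g n.
pose w := s n (n + 1) \co ker_in (diff X n (n - 1)).
exists (z - boundary Y n \co w); split.
  rewrite cmpDr cmpmN zE cmpA ker_liftE cmpA.
  have := congr1 (fun t => t \co ker_in (diff X n (n - 1))) (sE n).
  rewrite /= !cmpDl cmpNm -[s _ _ \co diff _ _ _ \co _]cmpA.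
  rewrite (kerP _).1 cmpm0 addr0 => <-.
  by rewrite opprB addrC subrK.
by rewrite hE cmpDr cmpmN cmpA (cokerP _).1 cmp0m subr0.
Qed.

(* The identifications H_0(Sigma^k X) = H_n(X) for n = -k, induced by the
   identity of X_n. *)
Definition shift_homology (X : complex C) k n (e : 0 - k = n) :
    hom (homology (shift k X) 0) (homology X n) :=
  @homology_map (shift k X) X 0 n (eq_hom X e).

Definition shift_homology_inv (X : complex C) k n (e : 0 - k = n) :
    hom (homology X n) (homology (shift k X) 0) :=
  @homology_map X (shift k X) n 0 (eq_hom X (esym e)).

End Homology.

Record proj_resolution (C : abelian) (A : C) := ProjResolution {
  pr_cpx :> complex C;
  pr_proj : forall n, is_projective (pr_cpx n);
  pr_neg : forall n, (n < 0)%R -> is_zero (pr_cpx n);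
  pr_exact : forall n, n <> 0 -> is_zero (homology pr_cpx n);
  pr_iso : iso (homology pr_cpx 0) A }.

Record inj_resolution (C : abelian) (B : C) := InjResolution {
  ir_cpx :> complex C;
  ir_inj : forall n, is_injective (ir_cpx n);
  ir_pos : forall n, (0 < n)%R -> is_zero (ir_cpx n);
  ir_exact : forall n, n <> 0 -> is_zero (homology ir_cpx n);
  ir_iso : iso B (homology ir_cpx 0) }.

Section HomologyIso.
Variable C : abelian.

Lemma mono_kernel_comp (W X Y K : C) (m : hom Y W) (f : hom X Y)
    (k : hom K X) : mono m -> is_kernel f k -> is_kernel (m \co f) k.
Proof.
move=> mm [fk0 kU]; split=> [|T g g0]; first by rewrite -cmpA fk0 cmpm0.
by apply: kU; apply: mm; rewrite cmpA g0 cmpm0.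
Qed.

Lemma epi_cokernel_comp (W X Y Q : C) (e : hom W X) (f : hom X Y)
    (q : hom Y Q) : epi e -> is_cokernel f q -> is_cokernel (f \co e) q.
Proof.
move=> ee [qf0 qU]; split=> [|T g g0]; first by rewrite cmpA qf0 cmp0m.
by apply: qU; apply: ee; rewrite -cmpA g0 cmp0m.
Qed.

Lemma epi_cokernel_ker (X Y : C) (e : hom X Y) :
  epi e -> is_cokernel (ker_in e) e.
Proof.
move=> ee; have [Z [f [ef0 fU]]] := epi_normal (abelianP C) ee.
split=> [|T g g0]; first exact: (kerP e).1.
by apply: fU; rewrite -(ker_liftE ef0) cmpA g0 cmp0m.
Qed.

Lemma mono_kernel_coker (X Y : C) (m : hom X Y) :
  mono m -> is_kernel (coker_pr m) m.
Proof.
move=> mm; have [Z [f [fm0 fU]]] := mono_normal (abelianP C) mm.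
split=> [|T g g0]; first exact: (cokerP m).1.
apply: fU; have [u [<- _]] := (cokerP m).2 _ _ fm0.
by rewrite -cmpA g0 cmpm0.
Qed.

Lemma homology_iso (X : complex C) p n q K A (k : hom K (X n))
    (r : hom (X p) K) (t : hom K A) : p = n + 1 -> q = n - 1 ->
  is_kernel (diff X n q) k -> k \co r = diff X p n -> is_cokernel r t ->
  exists i : iso (homology X n) A, True.
Proof.
move=> ep eq; move: r; rewrite ep eq => r [dk0 kU] kr [tr0 tU].
have [w [wE _]] := kU _ _ (kerP (diff X n (n - 1))).1.
have kmono T (a b : hom T K) : k \co a = k \co b -> a = b.
  move=> ab; have /kU[u [_ uU]] : diff X n (n - 1) \co (k \co b) = 0.
    by rewrite cmpA dk0 cmp0m.
  by rewrite -(uU _ ab); apply: uU.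
have tepi T (a b : hom A T) : a \co t = b \co t -> a = b.
  move=> ab; have /tU[u [_ uU]] : (b \co t) \co r = 0.
    by rewrite -cmpA tr0 cmpm0.
  by rewrite -(uU _ ab); apply: uU.
pose w' := ker_lift dk0.
have ww' : w \co w' = idm K.
  by apply: kmono; rewrite cmpA wE ker_liftE cmpm1.
have w'w : w' \co w = idm (cycles X n).
  by apply: (@ker_in_mono _ _ _ _); rewrite cmpA ker_liftE wE cmpm1.
have wb : w \co boundary X n = r.
  by apply: kmono; rewrite cmpA wE ker_liftE kr.
have tw0 : (t \co w) \co boundary X n = 0 by rewrite -cmpA wb tr0.
have [phi [phiE _]] := (cokerP (boundary X n)).2 _ _ tw0.
have pw0 : (coker_pr (boundary X n) \co w') \co r = 0.
  by rewrite -wb cmpA -[_ \co w' \co w]cmpA w'w cmpm1 (cokerP _).1.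
have [psi [psiE _]] := tU _ _ pw0.
unshelve eexists (@Iso _ _ _ phi psi _ _) => //.
  apply: (@coker_pr_epi _ _ _ (boundary X n)).
  by rewrite -cmpA phiE cmpA psiE -cmpA w'w cmpm1 cmp1m.
apply: tepi; rewrite -cmpA psiE cmpA phiE -cmpA ww' cmpm1 cmp1m //.
Qed.

Lemma iso_zero (X Y : C) : iso X Y -> is_zero Y -> is_zero X.
Proof.
move=> [f g gf _] [Y1 Y2].
have X0 : idm X = 0 by rewrite -gf (Y2 _ g) cmp0m.
by split=> Z u; [rewrite -(cmp1m u) X0 cmp0m|rewrite -(cmpm1 u) X0 cmpm0].
Qed.

Lemma homology_zero (X : complex C) p n q K (k : hom K (X n))
    (r : hom (X p) K) : p = n + 1 -> q = n - 1 ->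
  is_kernel (diff X n q) k -> k \co r = diff X p n -> epi r ->
  is_zero (homology X n).
Proof.
move=> ep eq kk kr re; have [Z [Z1 Z2]] := has_zero_object (abelianP C).
have tP : is_cokernel r (0 : hom K Z).
  split=> [|T g g0]; first by rewrite cmp0m.
  have -> : g = 0 by apply: re; rewrite g0 cmp0m.
  by exists 0; split=> [|u _]; rewrite ?cmp0m ?(Z2 _ u).
have [i _] := homology_iso ep eq kk kr tP.
exact: iso_zero i (conj Z1 Z2).
Qed.

Lemma homology_zero_obj (X : complex C) n :
  is_zero (X n) -> is_zero (homology X n).
Proof.
move=> [Z1 Z2]; have [Z [Z1' Z2']] := has_zero_object (abelianP C).
apply: (@homology_zero X (n + 1) n (n - 1) Z 0 0) => //.
- split=> [|T g _]; first by rewrite cmpm0.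
  by exists 0; split=> [|u _]; rewrite ?cmpm0 ?(Z1 _ g) ?(Z1' _ u).
- by rewrite cmpm0 (Z1 _ (diff _ _ _)).
- by move=> T a b _; rewrite (Z2' _ a) (Z2' _ b).
Qed.

Lemma kernel_id (X Y : C) : is_kernel (0 : hom X Y) (idm X).
Proof.
split=> [|T g _]; first by rewrite cmp0m.
by exists g; split=> [|u]; rewrite cmp1m.
Qed.

Lemma cokernel_id (X Y : C) : is_cokernel (0 : hom X Y) (idm Y).
Proof.
split=> [|T g _]; first by rewrite cmpm0.
by exists g; split=> [|u]; rewrite cmpm1.
Qed.

End HomologyIso.

Section ProjectiveResolutionExists.
Variables (C : abelian) (enough : enough_projectives C) (A Z : C).
Variable Z0 : is_zero Z.

Record proj_cover := ProjCover {
  cov_base : C;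
  cov_top : C;
  cov_map : hom cov_top cov_base;
  cov_proj : is_projective cov_top;
  cov_epi : epi cov_map }.

Definition cover_of (Y : C) : proj_cover :=
  let P := cid (enough Y) in
  let e := cid (projT2 P) in
  @ProjCover Y (projT1 P) (projT1 e) (projT2 e).1 (projT2 e).2.

Fixpoint pres n : proj_cover :=
  if n is n'.+1 then cover_of (ker (cov_map (pres n'))) else cover_of A.

Definition pres_diff n : hom (cov_top (pres n.+1)) (cov_top (pres n)) :=
  ker_in (cov_map (pres n)) \co cov_map (pres n.+1).

Lemma pres_diffK n : pres_diff n \co pres_diff n.+1 = 0.
Proof.
by rewrite /pres_diff -cmpA [cov_map _ \co _]cmpA (kerP _).1 cmp0m cmpm0.
Qed.

Definition pres_obj (n : int) : C :=
  if n is Posz k then cov_top (pres k) else Z.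

Definition pres_map (i j : int) : hom (pres_obj i) (pres_obj j) :=
  match i, j with
  | Posz a.+1, Posz b =>
    match @eqP _ a b with
    | ReflectT e =>
        ecast x (hom (cov_top (pres a.+1)) (cov_top (pres x))) e (pres_diff a)
    | ReflectF _ => 0
    end
  | _, _ => 0
  end.

Lemma pres_mapE n : pres_map (Posz n.+1) (Posz n) = pres_diff n.
Proof. by rewrite /=; case: eqP => // e; rewrite eq_axiomK. Qed.

Lemma pres_shape i j : i != j + 1 -> pres_map i j = 0.
Proof.
case: i j => [[|a]|a] [b|b] //= ij; case: eqP => // e; case/negP: ij.
by rewrite e -[Posz b + 1]PoszD addn1 eqxx.
Qed.

Lemma pres_mapK i j k : pres_map j k \co pres_map i j = 0.
Proof.
have [ij|/pres_shape->] := eqVneq i (j + 1); last by rewrite cmpm0.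
have [jk|/pres_shape->] := eqVneq j (k + 1); last by rewrite cmp0m.
case: k jk => [k|k]; last first.
  by case: j {ij} => [[|j]|j] /=; rewrite ?cmp0m.
rewrite -[Posz k + 1]PoszD addn1 => jk; move: ij; rewrite jk.
rewrite -[Posz k.+1 + 1]PoszD addn1 => ->.
by rewrite !pres_mapE pres_diffK.
Qed.

Definition pres_complex : complex C := Complex pres_shape pres_mapK.

Lemma proj_resolution_inhabited : inhabited (proj_resolution A).
Proof.
have zproj : is_projective Z.
  move=> X Y e f _; exists 0; rewrite cmpm0; exact/esym/(Z0.2 _ f).
have P1 : forall n, is_projective (pres_complex n).
  by move=> [n|n] //=; apply: cov_proj.
have P2 n : n < 0 -> is_zero (pres_complex n) by case: n.
have P3 n : n <> 0 -> is_zero (homology pres_complex n).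
  case: n => [[|n]|n] // _; last exact: homology_zero_obj.
  apply: (@homology_zero _ pres_complex (Posz n.+2) (Posz n.+1) (Posz n) _
    (ker_in (cov_map (pres n.+1))) (cov_map (pres n.+2))).
  - by rewrite -[_ + 1]PoszD addn1.
  - by rewrite -[n.+1]addn1 PoszD addrK.
  - rewrite [diff _ _ _]pres_mapE; apply: mono_kernel_comp; last exact: kerP.
    exact: ker_in_mono.
  - by rewrite [diff _ _ _]pres_mapE.
  - exact: cov_epi.
have [i _] : exists i : iso (homology pres_complex 0) A, True.
  apply: (@homology_iso _ pres_complex 1 0 (-1) _ _ (idm _)
    (pres_diff 0) (cov_map (pres 0))) => //.
  - exact: kernel_id.
  - by rewrite cmp1m [diff _ _ _]pres_mapE.
  - apply: epi_cokernel_comp; first exact: cov_epi.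
    exact/epi_cokernel_ker/cov_epi.
exact: inhabits (ProjResolution P1 P2 P3 i).
Qed.

End ProjectiveResolutionExists.

Section InjectiveResolutionExists.
Variables (C : abelian) (enough : enough_injectives C) (B Z : C).
Variable Z0 : is_zero Z.

Record inj_hull := InjHull {
  hull_base : C;
  hull_top : C;
  hull_map : hom hull_base hull_top;
  hull_inj : is_injective hull_top;
  hull_mono : mono hull_map }.

Definition hull_of (Y : C) : inj_hull :=
  let I := cid (enough Y) in
  let m := cid (projT2 I) in
  @InjHull Y (projT1 I) (projT1 m) (projT2 m).1 (projT2 m).2.

Fixpoint ires n : inj_hull :=
  if n is n'.+1 then hull_of (coker (hull_map (ires n'))) else hull_of B.

Definition ires_diff n : hom (hull_top (ires n)) (hull_top (ires n.+1)) :=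
  hull_map (ires n.+1) \co coker_pr (hull_map (ires n)).

Lemma ires_diffK n : ires_diff n.+1 \co ires_diff n = 0.
Proof.
by rewrite /ires_diff -cmpA [coker_pr _ \co _]cmpA (cokerP _).1 cmp0m cmpm0.
Qed.

Definition ires_obj (n : int) : C :=
  match n with
  | Posz 0 => hull_top (ires 0)
  | Posz _ => Z
  | Negz k => hull_top (ires k.+1)
  end.

Definition ires_map (i j : int) : hom (ires_obj i) (ires_obj j) :=
  match i, j with
  | Posz 0, Negz 0 => ires_diff 0
  | Negz a, Negz b =>
    match @eqP _ a.+1 b with
    | ReflectT e =>
        ecast x (hom (hull_top (ires a.+1)) (hull_top (ires x.+1))) e
          (ires_diff a.+1)
    | ReflectF _ => 0
    end
  | _, _ => 0
  end.

Lemma ires_mapE n : ires_map (Negz n) (Negz n.+1) = ires_diff n.+1.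
Proof. by rewrite /=; case: eqP => // e; rewrite eq_axiomK. Qed.

Lemma NegzS n : Negz n = Negz n.+1 + 1.
Proof. by rewrite !NegzE -[n.+2]addn1 PoszD opprD addrNK. Qed.

Lemma ires_shape i j : i != j + 1 -> ires_map i j = 0.
Proof.
case: i j => [[|a]|a] [b|[|b]] //= ij; case: eqP => // e; case/negP: ij.
by rewrite -e NegzS eqxx.
Qed.

Lemma ires_mapK i j k : ires_map j k \co ires_map i j = 0.
Proof.
have [ij|/ires_shape->] := eqVneq i (j + 1); last by rewrite cmpm0.
have [jk|/ires_shape->] := eqVneq j (k + 1); last by rewrite cmp0m.
case: k jk => [k|[|k]].
- by move=> _; case: j {ij} => [[|j]|j] /=; rewrite ?cmp0m.
- by move=> /= jk; move: ij; rewrite jk => /= ->; rewrite cmpm0.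
rewrite -NegzS => jk; move: ij; rewrite jk; case: k {jk} => [|k].
  by move=> -> ; rewrite ires_mapE; apply: ires_diffK.
by rewrite -NegzS => ->; rewrite !ires_mapE ires_diffK.
Qed.

Definition ires_complex : complex C := Complex ires_shape ires_mapK.

Lemma inj_resolution_inhabited : inhabited (inj_resolution B).
Proof.
have zinj : is_injective Z.
  move=> X Y e f _; exists 0; rewrite cmp0m; exact/esym/(Z0.1 _ f).
have I1 : forall n, is_injective (ires_complex n).
  move=> [[|n]|n]; [exact: (@hull_inj (ires 0))| |].
    exact: zinj.
  exact: (@hull_inj (ires n.+1)).
have I2 n : 0 < n -> is_zero (ires_complex n) by case: n => [[|n]|n].
have kP n : is_kernel (ires_diff n) (hull_map (ires n)).
  apply: mono_kernel_comp; first exact: hull_mono.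
  exact/mono_kernel_coker/hull_mono.
have I3 n : n <> 0 -> is_zero (homology ires_complex n).
  case: n => [[|n]|[|n]] // _; first exact: homology_zero_obj.
    apply: (@homology_zero _ ires_complex 0 (Negz 0) (Negz 1) _
      (hull_map (ires 1)) (coker_pr (hull_map (ires 0)))) => //.
      by rewrite [diff _ _ _]ires_mapE; apply: (kP 1).
    exact: coker_pr_epi.
  apply: (@homology_zero _ ires_complex (Negz n) (Negz n.+1) (Negz n.+2) _
    (hull_map (ires n.+2)) (coker_pr (hull_map (ires n.+1)))).
  - exact: NegzS.
  - by rewrite (NegzS n.+1) addrK.
  - by rewrite [diff _ _ _]ires_mapE; apply: (kP n.+2).
  - by rewrite [diff _ _ _]ires_mapE.
  - exact: coker_pr_epi.
have [i _] : exists i : iso (homology ires_complex 0) B, True.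
  apply: (@homology_iso _ ires_complex 1 0 (-1) _ _ (hull_map (ires 0))
    0 (idm B)) => //; [exact: (kP 0)|by rewrite cmpm0|].
  exact: cokernel_id.
exact: inhabits (InjResolution I1 I2 I3 (Iso (iso_invK i) (iso_homK i))).
Qed.

End InjectiveResolutionExists.

Lemma enough_proj_resolution (C : abelian) (A : C) :
  enough_projectives C -> inhabited (proj_resolution A).
Proof.
move=> enough; have [Z Z0] := has_zero_object (abelianP C).
exact: (@proj_resolution_inhabited C enough A Z Z0).
Qed.

Lemma enough_inj_resolution (C : abelian) (B : C) :
  enough_injectives C -> inhabited (inj_resolution B).
Proof.
move=> enough; have [Z Z0] := has_zero_object (abelianP C).
exact: (@inj_resolution_inhabited C enough B Z Z0).
Qed.

Lemma sub0NK (l : int) : 0 - - l = l.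
Proof. by rewrite opprK add0r. Qed.

Section CanonicalMaps.
Variable C : abelian.

(* For n = -k, the map Hom_K(P(A), Sigma^k X) -> Hom(A, H_n(X)) induced by
   H_0; it is inverse to u^n_(A,X) when the homology of X is concentrated in
   degree n. *)
Definition u_inv (A : C) (P : proj_resolution A) (X : complex C) k n
    (e : 0 - k = n) (a : homK P (shift k X)) : hom A (homology X n) :=
  shift_homology X e \co homologyK 0 a \co iso_inv (pr_iso P).

(* Hom_K(Sigma^-l Y, I(B)) -> Hom(H_l(Y), B), induced by H_0 *)
Definition v_inv (Y : complex C) (B : C) (I : inj_resolution B) l
    (b : homK (shift (- l) Y) I) : hom (homology Y l) B :=
  iso_inv (ir_iso I) \co homologyK 0 b \co shift_homology_inv Y (sub0NK l).

(* The inverse of v_inv when the homology of Y is concentrated in degree l,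
   in which case v_inv is bijective; the zero class is the default value of a
   total function. *)
Definition v_map (Y : complex C) (B : C) (I : inj_resolution B) l
    (f : hom (homology Y l) B) : homK (shift (- l) Y) I :=
  xget (\pi_(homK _ _) (zero_chain _ _)) [set b | v_inv b = f].

(* The lifts of f to resolutions form one class in the homotopy category. *)
Definition proj_lift (A A' : C) (P : proj_resolution A)
    (P' : proj_resolution A') (f : hom A A') : homK P P' :=
  xget (\pi_(homK _ _) (zero_chain _ _))
    [set a | pr_iso P' \co homologyK 0 a = f \co pr_iso P].

Definition inj_lift (B B' : C) (I : inj_resolution B)
    (I' : inj_resolution B') (f : hom B B') : homK I I' :=
  xget (\pi_(homK _ _) (zero_chain _ _))
    [set b | homologyK 0 b \co ir_iso I = ir_iso I' \co f].

End CanonicalMaps.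

Definition left_derived (A B : abelian) (F : additive_functor A B)
    (P : forall X : A, proj_resolution X) (i : int) : functor_data A B :=
  @FunctorData A B (fun X => homology (map_complex F (P X)) i)
    (fun X Y f => homologyK i (mapK F (proj_lift (P X) (P Y) f))).

Definition right_derived (A B : abelian) (G : additive_functor B A)
    (I : forall Y : B, inj_resolution Y) (i : int) : functor_data B A :=
  @FunctorData B A (fun X => homology (map_complex G (I X)) (- i))
    (fun X Y f => homologyK (- i) (mapK G (inj_lift (I X) (I Y) f))).

Section FixedObjects.
Variables (A B : abelian) (F : functor A B) (G : functor B A).
Variable FG : adjunction F G.
Variable P : forall X : A, proj_resolution X.
Variable I : forall Y : B, inj_resolution Y.

Let F' := left_adjoint FG.
Let G' := right_adjoint FG.
Let LF := left_derived F' P.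
Let RG := right_derived G' I.

Section AdjunctionK.
Variables (X : complex A) (W : complex B).

Lemma adj_chain_subproof (f : chain_map (map_complex F' X) W) i j :
  diff (map_complex G' W) i j \co adj FG (f i) = adj FG (f j) \co diff X i j.
Proof.
rewrite /= -adj_natr -adj_natl; congr (adj FG _); exact: (cmap_diff f i j).
Qed.

Definition adj_chain (f : chain_map (map_complex F' X) W) :
    chain_map X (map_complex G' W) :=
  @ChainMap _ X (map_complex G' W) _ (adj_chain_subproof f).

Definition adj_homK (a : homK (map_complex F' X) W) :
    homK X (map_complex G' W) :=
  \pi_(homK _ _) (adj_chain (repr a)).

Lemma adj_homK_pi (f : chain_map (map_complex F' X) W) :
  adj_homK (\pi_(homK _ _) f) = \pi_(homK _ _) (adj_chain f).
Proof.
apply/homKP.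
have /homKP[s sE] : \pi_(homK _ _) (repr (\pi_(homK _ _) f)) = \pi_(homK _ _) f.
  exact: reprK.
exists (fun i j => adj FG (s i j)) => n /=.
rewrite -adj_natr -adj_natl -adjD -(sE n).
by apply/eqP; rewrite subr_eq -adjD subrK.
Qed.

End AdjunctionK.

Lemma map_shift_subproof l (W : complex B) i j :
  diff (shift l (map_complex G' W)) i j \co idm (G (W (i - l))) =
  idm (G (W (j - l))) \co diff (map_complex G' (shift l W)) i j.
Proof.
rewrite /= cmpm1 cmp1m.
by rewrite (additive_mulrz (f := @fmap _ _ G _ _)) //; apply: (fmapD G').
Qed.

(* The equality G(Sigma^l W) = Sigma^l G(W), as a chain map. *)
Definition map_shift l (W : complex B) :
    chain_map (map_complex G' (shift l W)) (shift l (map_complex G' W)) :=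
  @ChainMap _ (map_complex G' (shift l W)) (shift l (map_complex G' W)) _
    (@map_shift_subproof l W).

Variable l : int.

(* Total in X and Y, but meant for LF i X = 0 = RG i Y for all i <> l, where
   every step is bijective. *)
Definition h_map (X : A) (Y : B) (f : hom (LF l X) Y) : hom X (RG l Y) :=
  let f1 : homK (shift (- l) (map_complex F' (P X))) (I Y) := v_map (I Y) f in
  let f2 : homK (map_complex F' (P X)) (shift l (I Y)) :=
    cmpK (shiftK l f1)
      (\pi_(homK _ _) (shift_shift l (map_complex F' (P X)))) in
  let f3 : homK (P X) (shift l (map_complex G' (I Y))) :=
    cmpK (\pi_(homK _ _) (map_shift l (I Y))) (adj_homK f2) in
  u_inv (sub0r l) f3.

Definition h_map_inv (X : A) (Y : B) (g : hom X (RG l Y)) : hom (LF l X) Y :=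
  xget 0 [set f | h_map f = g].

Definition eta (X : A) : hom X (RG l (LF l X)) := h_map (idm (LF l X)).

Definition eps (Y : B) : hom (LF l (RG l Y)) Y := h_map_inv (idm (RG l Y)).

Definition fixed (X : A) : Prop :=
  [/\ forall i, i <> l -> is_zero (LF i X),
      forall i, i <> l -> is_zero (RG i (LF l X))
    & is_iso (eta X)].

Definition cofixed (Y : B) : Prop :=
  [/\ forall i, i <> l -> is_zero (RG i Y),
      forall i, i <> l -> is_zero (LF i (RG l Y))
    & is_iso (eps Y)].

End FixedObjects.

(* Main.v *)
From mathcomp Require Import all_boot all_order all_algebra.
From mathcomp Require Import generic_quotient boolp classical_sets.
Require Import Defs.

Set Implicit Arguments.
Unset Strict Implicit.
Unset Printing Implicit Defensive.

Import Order.TTheory GRing.Theory Num.Theory.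
Local Open Scope ring_scope.
Local Open Scope quotient_scope.

(** The map [h] is bijective whenever the derived functors of both arguments
    are concentrated in degree l, and it is natural in both variables because
    each step of its construction is. Bijectivity rests on the comparison
    theorem: H_0 identifies homotopy classes of chain maps from a nonnegative
    complex of projectives to X with maps H_0 -> H_0(X) as soon as H_n(X) = 0
    for n > 0, and dually for nonpositive complexes of injectives; degreewise
    adjunction with the shift preserves and reflects homotopy.
    The rest is formal. Naturality turns h(eps) = 1 and eta = h(1) into
    naturality of eta and eps and the triangle identities
    eps_(LA) o L(eta_A) = 1 and R(eps_B) o eta_(RB) = 1; hence eps_(LA) is
    invertible when eta_A is, and eta_(RB) is invertible when eps_B is. The
    vanishing conditions on RLA and LRB are transported from A and B along eta
    and eps. *)

(** * Cancellation and isomorphisms in preadditive categories *)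

Section Preadditive.
Variable C : preadditive.
Implicit Types X Y Z : C.

Lemma cmpBl X Y Z (g g' : hom Y Z) (f : hom X Y) :
  (g - g') \co f = g \co f - g' \co f.
Proof. by rewrite cmpDl cmpNm. Qed.

Lemma cmpBr X Y Z (g : hom Y Z) (f f' : hom X Y) :
  g \co (f - f') = g \co f - g \co f'.
Proof. by rewrite cmpDr cmpmN. Qed.

Lemma mono_ker0 X Y (m : hom X Y) :
  (forall T (t : hom T X), m \co t = 0 -> t = 0) -> mono m.
Proof.
move=> m0 T a b ab; apply/eqP; rewrite -subr_eq0; apply/eqP/m0.
by rewrite cmpBr ab subrr.
Qed.

Lemma epi_coker0 X Y (e : hom X Y) :
  (forall T (t : hom Y T), t \co e = 0 -> t = 0) -> epi e.
Proof.
move=> e0 T a b ab; apply/eqP; rewrite -subr_eq0; apply/eqP/e0.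
by rewrite cmpBl ab subrr.
Qed.

End Preadditive.

Lemma fmap_is_iso (C D : preadditive) (H : functor_data C D) (X Y : C)
    (f : hom X Y) :
  is_functor H -> is_iso f -> is_iso (fmap H f).
Proof.
move=> HP [g [gf fg]]; exists (fmap H g).
by rewrite -!(fmap_cmp HP) gf fg !(fmap_id HP).
Qed.

Section IsIso.
Variables (C : preadditive) (X Y : C) (f : hom X Y) (g : hom Y X).

Lemma is_iso_left_inverse : is_iso g -> f \co g = idm Y -> is_iso f.
Proof.
move=> [h [hg gh]] fg; suff <- : h = f by exists g.
by rewrite -(cmp1m h) -fg -cmpA gh cmpm1.
Qed.

Lemma is_iso_right_inverse : is_iso g -> g \co f = idm X -> is_iso f.
Proof.
move=> [h [hg gh]] gf; suff <- : h = f by exists g.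
by rewrite -(cmpm1 h) -gf cmpA hg cmp1m.
Qed.

Lemma is_zero_source : is_iso f -> is_zero Y -> is_zero X.
Proof.
move=> [h [hf _]] [Y1 Y2].
have X0 : idm X = 0 by rewrite -hf (Y2 _ h) cmp0m.
by split=> Z u; [rewrite -(cmp1m u) X0 cmp0m|rewrite -(cmpm1 u) X0 cmpm0].
Qed.

Lemma is_zero_target : is_iso f -> is_zero X -> is_zero Y.
Proof.
move=> [h [_ fh]] [X1 X2].
have Y0 : idm Y = 0 by rewrite -fh (X1 _ h) cmpm0.
by split=> Z u; [rewrite -(cmp1m u) Y0 cmp0m|rewrite -(cmpm1 u) Y0 cmpm0].
Qed.

End IsIso.

(** * Images, lifting and extension in abelian categories *)

Section Exactness.
Variable C : abelian.
Implicit Types X Y Z : C.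

Lemma mono_ker_coker_fact X Y Z (m : hom X Y) (g : hom Z Y) :
  mono m -> coker_pr m \co g = 0 -> exists h : hom Z X, m \co h = g.
Proof.
by move=> /mono_kernel_coker[_ mU] /mU[h [hE _]]; exists h.
Qed.

Lemma epi_coker_ker_fact X Y Z (e : hom X Y) (g : hom X Z) :
  epi e -> g \co ker_in e = 0 -> exists h : hom Y Z, h \co e = g.
Proof.
by move=> /epi_cokernel_ker[_ eU] /eU[h [hE _]]; exists h.
Qed.

Lemma coker_fact X Y Z (f : hom X Y) (g : hom Y Z) :
  g \co f = 0 -> exists h, h \co coker_pr f = g.
Proof. by move=> /((cokerP f).2)[h [hE _]]; exists h. Qed.

Lemma epi_coker_pr0 X Y (f : hom X Y) : coker_pr f = 0 -> epi f.
Proof.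
move=> f0; apply: epi_coker0 => T t /coker_fact[h <-].
by rewrite f0 cmpm0.
Qed.

(* If [m \co t = 0], then f factors through [q \co e] with [q := coker_pr t],
   so e kills the kernel of the epimorphism [q \co e] and factors through it:
   q is a split monomorphism with [q \co t = 0]. *)
Lemma coimage_mono X Y (f : hom X Y) (m : hom (coker (ker_in f)) Y) :
  m \co coker_pr (ker_in f) = f -> mono m.
Proof.
set e := coker_pr _ => mE; have ee : epi e := @coker_pr_epi _ _ _ _.
apply: mono_ker0 => T t mt0; have [m' m'E] := coker_fact mt0.
pose q := coker_pr t; have eq : epi (q \co e).
  by move=> U a b; rewrite !cmpA => /ee/coker_pr_epi.
have /(epi_coker_ker_fact eq)[s sE] : e \co ker_in (q \co e) = 0.
  have /(@ker_lift_ex _ _ _ f)[u <-] : f \co ker_in (q \co e) = 0.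
    suff <- : m' \co ((q \co e) \co ker_in (q \co e)) = f \co ker_in (q \co e).
      by rewrite (kerP _).1 cmpm0.
    by rewrite !cmpA m'E mE.
  by rewrite cmpA (cokerP _).1 cmp0m.
have sq : s \co q = idm _ by apply: ee; rewrite -cmpA sE cmp1m.
by rewrite -(cmp1m t) -sq -cmpA (cokerP t).1 cmpm0.
Qed.

(** Dual to [coimage_mono]: if [t \co e = 0], then [f] factors through [m \co k] with
    [k := ker_in t], so the cokernel of [m \co k] kills [m], and [k] is a split epimorphism with
    [t \co k = 0]. *)
Lemma image_epi X Y (f : hom X Y) (e : hom X (ker (coker_pr f))) :
  ker_in (coker_pr f) \co e = f -> epi e.
Proof.
set m := ker_in _ => eE; have mm : mono m := @ker_in_mono _ _ _ _.
apply: epi_coker0 => T t te0; have [e' e'E] := ker_lift_ex te0.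
pose k := ker_in t; have mk : mono (m \co k).
  by move=> U a b; rewrite -!cmpA => /mm/ker_in_mono.
have /(mono_ker_coker_fact mk)[s sE] : coker_pr (m \co k) \co m = 0.
  have /coker_fact[u <-] : coker_pr (m \co k) \co f = 0.
    suff <- : coker_pr (m \co k) \co (m \co k) \co e' =
              coker_pr (m \co k) \co f.
      by rewrite (cokerP _).1 cmp0m.
    by rewrite -!cmpA e'E eE.
  by rewrite -cmpA (kerP _).1 cmpm0.
have ks : k \co s = idm _ by apply: mm; rewrite cmpA sE cmpm1.
by rewrite -(cmpm1 t) -ks cmpA (kerP t).1 cmp0m.
Qed.

(** The map [g] lands in the image [ker (coker_pr f)] of [f], onto which [X] maps epimorphically. *)
Lemma proj_lift_coker Q X Y (f : hom X Y) (g : hom Q Y) :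
  is_projective Q -> coker_pr f \co g = 0 -> exists h : hom Q X, f \co h = g.
Proof.
move=> Qproj /ker_lift_ex[g' <-]; have [e eE] := ker_lift_ex (cokerP f).1.
have [h <-] := Qproj _ _ _ g' (image_epi eE).
by exists h; rewrite cmpA eE.
Qed.

Lemma inj_extend_ker J X Y (f : hom X Y) (g : hom X J) :
  is_injective J -> g \co ker_in f = 0 -> exists h : hom Y J, h \co f = g.
Proof.
move=> Jinj /coker_fact[g' <-]; have [m mE] := coker_fact (kerP f).1.
have [h <-] := Jinj _ _ _ g' (coimage_mono mE).
by exists h; rewrite -cmpA mE.
Qed.

(** Exactness at [n] makes [proj_lift_coker] apply to [boundary X n]. Equations tie [p] and [q] to
    [n] so that degrees such as [n.+2] can be passed without casts. *)
Lemma exact_proj_lift Q (X : complex C) p n q (g : hom Q (X n)) :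
  is_projective Q -> is_zero (homology X n) -> p = n + 1 -> q = n - 1 ->
  diff X n q \co g = 0 -> exists h, diff X p n \co h = g.
Proof.
move=> Qproj [H0 _] -> -> /ker_lift_ex[g' <-].
have [h <-] := proj_lift_coker Qproj (H0 _ (coker_pr (boundary X n) \co g')).
by exists h; rewrite cmpA ker_liftE.
Qed.

Lemma exact_inj_extend J (X : complex C) p n q (g : hom (X n) J) :
  is_injective J -> is_zero (homology X n) -> p = n + 1 -> q = n - 1 ->
  g \co diff X p n = 0 -> exists h, h \co diff X n q = g.
Proof.
move=> Jinj [H0 _] -> -> gd0; apply: inj_extend_ker => //.
apply: (epi_coker_pr0 (H0 _ _ : coker_pr (boundary X n) = 0)).
by rewrite -cmpA ker_liftE cmp0m.
Qed.

End Exactness.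

(** [Q] is the invariant that keeps the recursion going; in the uses below it says that one more
    component of a chain map or of a homotopy exists. *)
Lemma dependent_choice (T : nat -> Type) (Q : forall n, T n -> Prop)
    (R : forall n, T n -> T n.+1 -> Prop) (x0 : T 0) :
  Q 0 x0 -> (forall n x, Q n x -> exists y, Q n.+1 y /\ R n x y) ->
  exists s : forall n, T n, s 0 = x0 /\ forall n, R n (s n) (s n.+1).
Proof.
move=> Qx0 step.
pose next n (x : {x | Q n x}) := cid (step n (sval x) (svalP x)).
pose s := fix s n : {x : T n | Q n x} :=
  if n is n'.+1 then
    let y := next n' (s n') in exist _ (sval y) (proj1 (svalP y))
  else exist _ x0 Qx0.
by exists (fun n => sval (s n)); split=> // n; case: (svalP (next n (s n))).
Qed.

Lemma PoszS1 (n : nat) : Posz n + 1 = Posz n.+1.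
Proof. by rewrite -PoszD addn1. Qed.

Lemma PoszSB1 (n : nat) : Posz n.+1 - 1 = Posz n.
Proof. by rewrite -PoszS1 addrK. Qed.

Lemma NegzB1 (n : nat) : Negz n - 1 = Negz n.+1.
Proof. by rewrite NegzS addrK. Qed.

(** * Comparison of resolutions *)

Section GradedFamilies.
Variables (C : preadditive) (X Y : complex C).

Lemma chain_map_nonneg (phi : forall n : nat, hom (X n) (Y n)) :
  diff Y 0 (-1) \co phi 0 = 0 ->
  (forall n, diff Y n.+1 n \co phi n.+1 = phi n \co diff X n.+1 n) ->
  exists f : chain_map X Y, forall n : nat, f n = phi n.
Proof.
move=> phi0 phiS.
pose c i : hom (X i) (Y i) := if i is Posz n then phi n else 0.
suff cE i j : diff Y i j \co c i = c j \co diff X i j by exists (ChainMap cE).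
have [->|ij] := eqVneq i (j + 1); last by rewrite !diff_shape ?cmpm0 ?cmp0m.
case: j => [n|[|n]]; first by rewrite PoszS1 phiS.
  by rewrite /= cmp0m phi0.
by rewrite -NegzS /= cmp0m cmpm0.
Qed.

(** [- Posz n] computes to [Posz 0] or to some [Negz _], so [phi] fills the degrees up to 0 without
    casts. *)
Lemma chain_map_nonpos
    (phi : forall n : nat, hom (X (- Posz n)) (Y (- Posz n))) :
  phi 0 \co diff X 1 0 = 0 ->
  (forall n, diff Y (- Posz n) (- Posz n.+1) \co phi n =
             phi n.+1 \co diff X (- Posz n) (- Posz n.+1)) ->
  exists f : chain_map X Y, forall n : nat, f (- Posz n) = phi n.
Proof.
move=> phi0 phiS.
pose c i : hom (X i) (Y i) :=
  match i with Posz 0 => phi 0 | Posz _.+1 => 0 | Negz n => phi n.+1 end.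
suff cE i j : diff Y i j \co c i = c j \co diff X i j.
  by exists (ChainMap cE) => -[|n].
have [->|ij] := eqVneq i (j + 1); last by rewrite !diff_shape ?cmpm0 ?cmp0m.
case: j => [[|n]|[|n]]; [|by rewrite PoszS1 /= cmp0m cmpm0| |].
- by rewrite /= cmpm0 phi0.
- exact: (phiS 0).
- by rewrite -NegzS; apply: (phiS n.+1).
Qed.

Lemma homotopy_nonneg (f : chain_map X Y)
    (s : forall n : nat, hom (X n) (Y n.+1)) :
  (forall n : int, n < 0 -> is_zero (X n)) ->
  f 0 = diff Y 1 0 \co s 0 ->
  (forall n, f n.+1 = diff Y n.+2 n.+1 \co s n.+1 + s n \co diff X n.+1 n) ->
  exists S : forall i j, hom (X i) (Y j), forall n,
    f n = diff Y (n + 1) n \co S n (n + 1) + S (n - 1) n \co diff X n (n - 1).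
Proof.
move=> X0 f0 fS.
(* A homotopy is indexed by source and target, so on the line j = i + 1 it is a cast of [s], undone
   by [eq_axiomK]. *)
pose S i j : hom (X i) (Y j) :=
  match i, j with
  | Posz a, Posz b =>
    match @eqP _ a.+1 b with
    | ReflectT e => ecast x (hom (X a) (Y (Posz x))) e (s a)
    | ReflectF _ => 0
    end
  | _, _ => 0
  end.
have SE (n : nat) : S n n.+1 = s n.
  by rewrite /S; case: eqP => // e; rewrite eq_axiomK.
exists S => -[[|n]|n].
- by rewrite ((X0 (0 - 1) isT).2 _ (S _ _)) cmp0m addr0 f0 -SE.
- by rewrite PoszS1 PoszSB1 fS !SE.
(* In negative degrees both sides start at a zero object. *)
- have [_ XE] := X0 (Negz n) isT.
  by rewrite (XE _ (f _)); apply/esym/XE.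
Qed.

Lemma homotopy_nonpos (f : chain_map X Y)
    (s : forall n : nat, hom (X (- Posz n.+1)) (Y (- Posz n))) :
  (forall n : int, 0 < n -> is_zero (Y n)) ->
  f 0 = s 0 \co diff X 0 (-1) ->
  (forall n, f (- Posz n.+1) =
     diff Y (- Posz n) (- Posz n.+1) \co s n +
     s n.+1 \co diff X (- Posz n.+1) (- Posz n.+2)) ->
  exists S : forall i j, hom (X i) (Y j), forall n,
    f n = diff Y (n + 1) n \co S n (n + 1) + S (n - 1) n \co diff X n (n - 1).
Proof.
move=> Y0 f0 fS.
pose S i j : hom (X i) (Y j) :=
  match i with
  | Negz a =>
    match @eqP _ (- Posz a) j with
    | ReflectT e => ecast x (hom (X (Negz a)) (Y x)) e (s a)
    | ReflectF _ => 0
    end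
  | _ => 0
  end.
have SE (n : nat) : S (- Posz n.+1) (- Posz n) = s n.
  by rewrite /S /=; case: eqP => // e; rewrite eq_axiomK.
exists S => -[[|n]|n].
- rewrite ((Y0 (0 + 1) isT).1 _ (S _ _)) cmpm0 add0r f0; congr cmp.
  exact/esym/(SE 0).
- have [YE _] := Y0 (Posz n.+1) isT.
  by rewrite (YE _ (f _)); apply/esym/YE.
(* The degrees are brought to the form [- Posz _] in which [fS] is stated. *)
- rewrite NegzB1 (_ : Negz n + 1 = - Posz n); last first.
    by case: n => // n; rewrite -NegzS.
  by rewrite -[Negz n.+1]/(- Posz n.+2) -[Negz n]/(- Posz n.+1) fS !SE.
Qed.

Lemma sub_chain_subproof (f g : chain_map X Y) i j :
  diff Y i j \co (f i - g i) = (f j - g j) \co diff X i j.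
Proof. by rewrite cmpBl cmpBr !cmap_diff. Qed.

Definition sub_chain (f g : chain_map X Y) : chain_map X Y :=
  ChainMap (sub_chain_subproof f g).

End GradedFamilies.

Section Induces.
Variable C : abelian.
Implicit Types X Y Z : complex C.

Lemma induces_id X n : induces (idm (X n)) (idm (homology X n)).
Proof. by exists (idm _); rewrite !cmp1m !cmpm1. Qed.

Lemma induces_cmp X Y Z m n p (g : hom (Y n) (Z p)) (f : hom (X m) (Y n)) h k :
  induces g h -> induces f k -> induces (g \co f) (h \co k).
Proof.
move=> [z [zE hE]] [w [wE kE]]; exists (z \co w); split.
  by rewrite cmpA zE -!cmpA wE.
by rewrite -cmpA kE !cmpA hE.
Qed.

Lemma inducesB X Y m n (f g : hom (X m) (Y n)) h k :
  induces f h -> induces g k -> induces (f - g) (h - k).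
Proof.
move=> [z [zE hE]] [w [wE kE]]; exists (z - w).
by rewrite !cmpBl !cmpBr zE wE hE kE.
Qed.

(** [homology_map] is a choice; it is computed by exhibiting any map that satisfies [induces]. *)
Lemma homology_mapE X Y n (f : chain_map X Y) h :
  induces (f n) h -> homology_map (f n) = h.
Proof. exact/induces_unique/chain_map_induces. Qed.

Lemma homology_map_cmp X Y Z n (g : chain_map Y Z) (f : chain_map X Y) :
  homology_map (cmp_chain g f n) = homology_map (g n) \co homology_map (f n).
Proof.
by apply: homology_mapE; apply: induces_cmp; apply: chain_map_induces.
Qed.

(** Holds by computation; it lets the lemmas on a single null-homotopic chain map apply to a
    pair. *)
Lemma homotopic_sub X Y (f g : chain_map X Y) :
  (exists S : forall i j, hom (X i) (Y j), forall n, sub_chain f g n =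
    diff Y (n + 1) n \co S n (n + 1) + S (n - 1) n \co diff X n (n - 1)) ->
  homotopic f g.
Proof. by []. Qed.

End Induces.

Section Comparison.
Variable C : abelian.
Implicit Types X Y : complex C.

(** Degree by degree: projectivity of X_0 lifts [h] to cycles, and in higher degrees exactness of
    [Y] supplies each next component. *)
Lemma proj_comparison_ex X Y (h : hom (homology X 0) (homology Y 0)) :
  (forall n, is_projective (X n)) -> (forall n : int, n < 0 -> is_zero (X n)) ->
  (forall n : int, 0 < n -> is_zero (homology Y n)) ->
  exists f : chain_map X Y, homology_map (f 0) = h.
Proof.
move=> Xproj X0 Y0.
(* As X_(-1) is zero, all of X_0 consists of cycles: [i] and [j] are mutually inverse. *)
have dX0 : diff X 0 (0 - 1) \co idm _ = 0.
  by have [XE _] := X0 (0 - 1) isT; apply: XE.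
pose j := ker_lift dX0; pose i := ker_in (diff X 0 (0 - 1)).
have ij : i \co j = idm _ by apply: ker_liftE.
have ji : j \co i = idm _.
  by apply: (@ker_in_mono _ _ _ _); rewrite cmpA ij cmp1m cmpm1.
have jd : j \co diff X 1 0 = boundary X 0.
  by rewrite -(ker_liftE (diffK X 1 0 (0 - 1))) cmpA ji cmp1m.
have [g gE] : exists g : hom (X 0) (cycles Y 0), coker_pr (boundary Y 0) \co g =
    h \co coker_pr (boundary X 0) \co j.
  exact: (Xproj 0 _ _ _ _ (@coker_pr_epi _ _ _ _)).
pose phi0 := ker_in (diff Y 0 (0 - 1)) \co g.
(* H_0(Y) may be nonzero, so degree 1 is treated apart: [g] covers [h], hence sends boundaries to
   boundaries. *)
have [phi1 phi1E] : exists phi1, diff Y 1 0 \co phi1 = phi0 \co diff X 1 0.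
  have [|k kE] := @proj_lift_coker _ _ _ _ (boundary Y 0) (g \co diff X 1 0)
    (Xproj 1).
    by rewrite cmpA gE -!cmpA jd (cokerP _).1 cmpm0.
  by exists k; rewrite /phi0 -cmpA -kE cmpA ker_liftE.
have [|n phi [psi psiE]|phi [phi_0 phiS]] := @dependent_choice
  (fun n => hom (X (Posz n)) (Y (Posz n)))
  (fun n phi => exists psi, diff Y n.+1 n \co psi = phi \co diff X n.+1 n)
  (fun n phi psi => diff Y n.+1 n \co psi = phi \co diff X n.+1 n) phi0.
- by exists phi1.
- exists psi; split=> //.
  have [|k kE] := @exact_proj_lift _ _ Y n.+2 n.+1 n (psi \co diff X n.+2 n.+1)
    (Xproj n.+2) (Y0 n.+1 isT) (esym (PoszS1 _)) (esym (PoszSB1 _)).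
    by rewrite cmpA psiE -cmpA diffK cmpm0.
  by exists k.
have [|//|f fE] := @chain_map_nonneg _ X Y phi.
  by rewrite phi_0 /phi0 cmpA (kerP _).1 cmp0m.
exists f; apply: homology_mapE; rewrite (fE 0) phi_0.
exists (g \co i); split; first by rewrite /phi0 -cmpA.
by rewrite cmpA gE -[_ \co j \co i]cmpA ji cmpm1.
Qed.

(** The difference induces zero on H_0, so in degree 0 it factors through the boundaries of [Y].
    Each later error, [d] minus the known term of the homotopy, is a cycle, and lifts by exactness
    of [Y] in positive degrees. *)
Lemma proj_comparison_unique X Y (f g : chain_map X Y) :
  (forall n, is_projective (X n)) -> (forall n : int, n < 0 -> is_zero (X n)) ->
  (forall n : int, 0 < n -> is_zero (homology Y n)) ->
  homology_map (f 0) = homology_map (g 0) -> homotopic f g.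
Proof.
move=> Xproj X0 Y0 fg; apply: homotopic_sub; set d := sub_chain f g.
have [z [zE]] : induces (d 0) 0.
  rewrite -(subrr (homology_map (g 0))) -{1}fg.
  by apply: inducesB; apply: chain_map_induces.
rewrite cmp0m => cz.
have dX0 : diff X 0 (0 - 1) \co idm _ = 0.
  by have [XE _] := X0 (0 - 1) isT; apply: XE.
have [|s0 s0E] := @proj_lift_coker _ _ _ _ (boundary Y 0)
  (z \co ker_lift dX0) (Xproj 0).
  by rewrite cmpA -cz cmp0m.
have {z zE cz} s0E : diff Y 1 0 \co s0 = d 0.
  rewrite -(ker_liftE (diffK Y 1 0 (0 - 1))) -cmpA [ker_lift _ \co s0]s0E.
  by rewrite cmpA zE -cmpA ker_liftE cmpm1.
pose R n (s : hom (X (Posz n)) (Y (Posz n.+1))) t :=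
  d (Posz n.+1) = diff Y n.+2 n.+1 \co t + s \co diff X n.+1 n.
have [|n s [t tE]|s [s_0 sS]] := @dependent_choice
  (fun n => hom (X (Posz n)) (Y (Posz n.+1))) (fun n s => exists t, R n s t)
  R s0.
- have [|t tE] := @exact_proj_lift _ _ Y 2 1 0 (d 1 - s0 \co diff X 1 0)
    (Xproj 1) (Y0 1 isT) erefl erefl.
    by rewrite cmpBr cmap_diff cmpA s0E subrr.
  by exists t; rewrite /R tE subrK.
- exists t; split=> //.
  have [|u uE] := @exact_proj_lift _ _ Y n.+3 n.+2 n.+1
    (d n.+2 - t \co diff X n.+2 n.+1) (Xproj _) (Y0 n.+2 isT)
    (esym (PoszS1 _)) (esym (PoszSB1 _)).
    by rewrite cmpBr cmap_diff tE cmpDl -!cmpA diffK cmpm0 addr0 subrr.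
  by exists u; rewrite /R uE subrK.
by apply: (homotopy_nonneg (s := s)) => //; rewrite s_0.
Qed.

(** Dual to [proj_comparison_ex]: components are extended along the differentials of [X] instead of
    lifted. *)
Lemma inj_comparison_ex X Y (h : hom (homology X 0) (homology Y 0)) :
  (forall n, is_injective (Y n)) -> (forall n : int, 0 < n -> is_zero (Y n)) ->
  (forall n : int, n < 0 -> is_zero (homology X n)) ->
  exists f : chain_map X Y, homology_map (f 0) = h.
Proof.
move=> Yinj Y0 X0.
(* As Y_1 is zero, H_0(Y) is the object of 0-cycles, and [r] inverts the projection onto it. *)
have bY0 : idm _ \co boundary Y 0 = 0.
  by rewrite ((Y0 (0 + 1) isT).2 _ (boundary Y 0)) cmpm0.
have [r rc] := coker_fact bY0.
have cr : coker_pr (boundary Y 0) \co r = idm _.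
  by apply: (@coker_pr_epi _ _ _ (boundary Y 0)); rewrite -cmpA rc cmp1m cmpm1.
pose z := r \co h \co coker_pr (boundary X 0).
have [phi0 phi0E] := Yinj 0 _ _ _ (ker_in (diff Y 0 (0 - 1)) \co z)
  (@ker_in_mono _ _ _ (diff X 0 (0 - 1))).
have [phi1 phi1E] :
    exists phi1, phi1 \co diff X 0 (-1) = diff Y 0 (-1) \co phi0.
  apply: inj_extend_ker => //.
  by rewrite -cmpA [phi0 \co _]phi0E cmpA (kerP (diff Y 0 (0 - 1))).1 cmp0m.
have [|n phi [psi psiE]|phi [phi_0 phiS]] := @dependent_choice
  (fun n => hom (X (- Posz n)) (Y (- Posz n)))
  (fun n phi => exists psi, psi \co diff X (- Posz n) (- Posz n.+1)
     = diff Y (- Posz n) (- Posz n.+1) \co phi)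
  (fun n phi psi => psi \co diff X (- Posz n) (- Posz n.+1)
     = diff Y (- Posz n) (- Posz n.+1) \co phi) phi0.
- by exists phi1.
- exists psi; split=> //.
  apply: (exact_inj_extend (p := - Posz n) (q := - Posz n.+2) (Yinj _)
    (X0 (- Posz n.+1) isT)).
  + by case: n {phi psi psiE} => // n; apply: NegzS.
  + exact/esym/NegzB1.
  + by rewrite -cmpA psiE cmpA diffK cmp0m.
have [||f fE] := @chain_map_nonpos _ X Y phi.
(* The differential from X_1 factors through the boundary map; on cycles [phi0] is [z], which kills
   boundaries. *)
- rewrite phi_0 -(ker_liftE (diffK X 1 0 (0 - 1))) cmpA phi0E -cmpA /z -!cmpA.
  by rewrite [coker_pr _ \co _](cokerP (boundary X 0)).1 !cmpm0.
- by move=> n; rewrite phiS.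
exists f; apply: homology_mapE; rewrite (fE 0) phi_0.
exists z; split; first by rewrite phi0E.
by rewrite /z !cmpA cr cmp1m.
Qed.

Lemma inj_comparison_unique X Y (f g : chain_map X Y) :
  (forall n, is_injective (Y n)) -> (forall n : int, 0 < n -> is_zero (Y n)) ->
  (forall n : int, n < 0 -> is_zero (homology X n)) ->
  homology_map (f 0) = homology_map (g 0) -> homotopic f g.
Proof.
move=> Yinj Y0 X0 fg; apply: homotopic_sub; set d := sub_chain f g.
have [z [zE]] : induces (d 0) 0.
  rewrite -(subrr (homology_map (g 0))) -{1}fg.
  by apply: inducesB; apply: chain_map_induces.
rewrite cmp0m => cz.
have bY0 : idm _ \co boundary Y 0 = 0.
  by rewrite ((Y0 (0 + 1) isT).2 _ (boundary Y 0)) cmpm0.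
have [r rc] := coker_fact bY0.
(* The projection to H_0(Y) has the left inverse [r], so [z] vanishes and [d] kills the 0-cycles of
   [X]. *)
have {rc cz} z0 : z = 0 by rewrite -(cmp1m z) -rc -cmpA -cz cmpm0.
have [s0 s0E] : exists s0, s0 \co diff X 0 (-1) = d 0.
  by apply: inj_extend_ker => //; rewrite -[LHS]zE z0 cmpm0.
pose R n (s : hom (X (- Posz n.+1)) (Y (- Posz n))) t :=
  d (- Posz n.+1) = diff Y (- Posz n) (- Posz n.+1) \co s +
                    t \co diff X (- Posz n.+1) (- Posz n.+2).
(* Used for both the base case and the induction: an error that kills the incoming differential
   extends along the outgoing one. *)
have step n s : (d (- Posz n.+1) - diff Y (- Posz n) (- Posz n.+1) \co s)
    \co diff X (- Posz n) (- Posz n.+1) = 0 -> exists t, R n s t.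
  move=> s0'; have [||t tE] := exact_inj_extend (p := - Posz n)
    (q := - Posz n.+2) (Yinj (- Posz n.+1)) (X0 (- Posz n.+1) isT) _ _ s0'.
  - by case: (n) => // k; apply: NegzS.
  - exact/esym/NegzB1.
  by exists t; rewrite /R tE addrC subrK.
have [|n s [t tE]|s [s_0 sS]] := @dependent_choice
  (fun n => hom (X (- Posz n.+1)) (Y (- Posz n)))
  (fun n s => exists t, R n s t) R s0.
- by apply: step; rewrite cmpBl -cmap_diff -cmpA s0E subrr.
- exists t; split=> //; apply: step.
  by rewrite cmpBl -cmap_diff tE cmpDr !cmpA diffK cmp0m add0r subrr.
by apply: (homotopy_nonpos (s := s)) => //; rewrite s_0.
Qed.

End Comparison.

(** * Homology of shifted complexes and derived functors *)

Section ShiftHomology.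
Variable C : abelian.
Implicit Types X Y : complex C.

Lemma signrzK (V : zmodType) (x : V) (k : int) : x *~ (-1) ^ k *~ (-1) ^ k = x.
Proof. by rewrite -mulrzA -exprzMl ?unitrN1 // mulrNN mulr1 exp1rz mulr1z. Qed.

Lemma epi_exact X p n q : is_zero (homology X n) -> p = n + 1 -> q = n - 1 ->
  epi (ker_lift (diffK X p n q)).
Proof.
(* The proof [diffK X p n q] is generalized so that [p] and [q] can be replaced in its type. *)
move=> [H0 _] ep eq; move: ep eq (diffK X p n q) => -> -> dd.
have -> : ker_lift dd = boundary X n.
  by apply: (@ker_in_mono _ _ _ _); rewrite !ker_liftE.
exact: epi_coker_pr0 (H0 _ _).
Qed.

(** The sign of the shifted differential changes neither its kernel nor whether the map onto cycles
    is epi. *)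
Lemma homology_shift_zero X k n m :
  n - k = m -> is_zero (homology X m) -> is_zero (homology (shift k X) n).
Proof.
move=> <- H0; pose r := ker_lift (diffK X (n + 1 - k) (n - k) (n - 1 - k)).
pose i := ker_in (diff X (n - k) (n - 1 - k)).
apply: (@homology_zero _ (shift k X) (n + 1) n (n - 1) _ i
  (r *~ (-1) ^ k)) => //=.
- split=> [|T g]; first by rewrite cmpMzl (kerP _).1 mul0rz.
  rewrite cmpMzl => /(congr1 (fun t => t *~ (-1) ^ k)).
  by rewrite signrzK mul0rz => /((kerP _).2).
- by rewrite cmpMzr ker_liftE.
- move=> T a b; rewrite !cmpMzr => /(congr1 (fun t => t *~ (-1) ^ k)).
  by rewrite !signrzK; apply: epi_exact => //; rewrite addrAC.
Qed.

Lemma eq_hom_cmp X i j m (e : i = j) (e' : j = m) :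
  eq_hom X e' \co eq_hom X e = eq_hom X (etrans e e').
Proof. by case: m / e'; rewrite cmp1m. Qed.

Lemma eq_hom_id X i (e : i = i) : eq_hom X e = idm (X i).
Proof. by rewrite (eq_irrelevance e erefl). Qed.

(** Stated for arbitrary degreewise families, so that it also covers components that come from the
    adjunction. *)
Lemma eq_hom_family X Y (f : forall n, hom (X n) (Y n)) i j (e : i = j) :
  f j \co eq_hom X e = eq_hom Y e \co f i.
Proof. by case: j / e; rewrite cmpm1 cmp1m. Qed.

(** The casts in the two neighbouring degrees carry the factor (-1)^k, which absorbs the sign of the
    shifted differential. *)
Lemma shift_homology_induces X k n (e : 0 - k = n) :
  @induces C (shift k X) X 0 n (eq_hom X e) (shift_homology X e).
Proof.
have ep : 0 + 1 - k = n + 1 by rewrite -e addrAC.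
have em : 0 - 1 - k = n - 1 by rewrite -e addrAC.
apply: (@homology_mapP _ (shift k X) X 0 n _ (eq_hom X ep *~ (-1) ^ k)
  (eq_hom X em *~ (-1) ^ k));
  rewrite /= ?cmpMzl !cmpMzr ?signrzK; last exact: eq_hom_diff.
congr (_ *~ _); exact: eq_hom_diff.
Qed.

Lemma shift_homology_inv_induces X k n (e : 0 - k = n) :
  @induces C X (shift k X) n 0 (eq_hom X (esym e)) (shift_homology_inv X e).
Proof.
have ep : n + 1 = 0 + 1 - k by rewrite -e addrAC.
have em : n - 1 = 0 - 1 - k by rewrite -e addrAC.
apply: (@homology_mapP _ X (shift k X) n 0 _ (eq_hom X ep *~ (-1) ^ k)
  (eq_hom X em *~ (-1) ^ k));
  rewrite /= !cmpMzl ?cmpMzr ?signrzK; first exact: eq_hom_diff.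
congr (_ *~ _); exact: eq_hom_diff.
Qed.

(** The composite is induced by a cast along a loop in [int], which is the identity. *)
Lemma shift_homologyK X k n (e : 0 - k = n) :
  shift_homology X e \co shift_homology_inv X e = idm _.
Proof.
apply: (@induces_unique _ X X n n (idm _)); last exact: induces_id.
rewrite -(eq_hom_id X (etrans (esym e) e)) -eq_hom_cmp.
exact: (@induces_cmp _ X (shift k X) X _ _ _ _ _ _ _
  (shift_homology_induces X e) (shift_homology_inv_induces X e)).
Qed.

Lemma shift_homology_invK X k n (e : 0 - k = n) :
  shift_homology_inv X e \co shift_homology X e = idm _.
Proof.
apply: (@induces_unique _ (shift k X) (shift k X) 0 0 (idm (X (0 - k))));
  last exact: (induces_id (shift k X) 0).
rewrite -(eq_hom_id X (etrans e (esym e))) -eq_hom_cmp.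
exact: (@induces_cmp _ (shift k X) X (shift k X) _ _ _ _ _ _ _
  (shift_homology_inv_induces X e) (shift_homology_induces X e)).
Qed.

Lemma shift_homology_nat X Y (f : chain_map X Y) k n (e : 0 - k = n) :
  shift_homology Y e \co homology_map (shift_chain k f 0) =
  homology_map (f n) \co shift_homology X e.
Proof.
apply: (@induces_unique _ (shift k X) Y 0 n (eq_hom Y e \co f (0 - k))).
  exact: (@induces_cmp _ (shift k X) (shift k Y) Y _ _ _ _ _ _ _
    (shift_homology_induces Y e) (chain_map_induces (shift_chain k f) 0)).
rewrite -eq_hom_family.
exact: (@induces_cmp _ (shift k X) X Y _ _ _ _ _ _ _ (chain_map_induces f n)
  (shift_homology_induces X e)).
Qed.

Lemma shift_homology_inv_nat X Y (f : chain_map X Y) k n (e : 0 - k = n) :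
  shift_homology_inv Y e \co homology_map (f n) =
  homology_map (shift_chain k f 0) \co shift_homology_inv X e.
Proof.
rewrite -[RHS]cmp1m -(shift_homology_invK Y e) -!cmpA; congr cmp.
by rewrite [RHS]cmpA shift_homology_nat -cmpA shift_homologyK cmpm1.
Qed.

End ShiftHomology.

(** * Bijectivity of the canonical maps, and lifts to resolutions *)

Section CanonicalMaps.
Variable C : abelian.
Implicit Types X Y : complex C.

Lemma iso_cmpl_inj (A B D : C) (i : iso A B) (f g : hom D A) :
  i \co f = i \co g -> f = g.
Proof.
move=> /(congr1 (cmp (iso_inv i))); rewrite !cmpA iso_homK !cmp1m //.
Qed.

Lemma iso_cmpr_inj (A B D : C) (i : iso A B) (f g : hom B D) :
  f \co i = g \co i -> f = g.
Proof.
by move=> /(congr1 (fun t => t \co iso_inv i)); rewrite -!cmpA iso_invK !cmpm1.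
Qed.

Definition iso_sym (A B : C) (i : iso A B) : iso B A :=
  Iso (iso_invK i) (iso_homK i).

Lemma homK_piP X Y (a : homK X Y) : exists f, a = \pi_(homK X Y) f.
Proof. by exists (repr a); rewrite reprK. Qed.

Section U.
Variables (A : C) (P : proj_resolution A) (X : complex C) (k n : int).
Variables (e : 0 - k = n) (X0 : forall m, n < m -> is_zero (homology X m)).

Lemma homology_shift_pos_zero m : 0 < m -> is_zero (homology (shift k X) m).
Proof.
move=> m0; apply: homology_shift_zero erefl _; apply: X0.
by rewrite -e ltrD2r.
Qed.

(** Up to isomorphisms at both ends [u_inv] is H_0, so this is the uniqueness half of the comparison
    theorem for the shift of [X]; the existence half gives [u_inv_surj]. *)
Lemma u_inv_inj : injective (u_inv (P := P) (X := X) e).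
Proof.
move=> a b; have [f ->] := homK_piP a; have [g ->] := homK_piP b.
rewrite /u_inv !homologyK_pi => /(@iso_cmpr_inj _ _ _ (iso_sym _)).
move=> /(congr1 (cmp (shift_homology_inv X e))).
rewrite !cmpA shift_homology_invK !cmp1m => fg; apply/homKP.
exact: proj_comparison_unique (@pr_proj _ _ P) (@pr_neg _ _ P)
  homology_shift_pos_zero fg.
Qed.

Lemma u_inv_surj h :
  exists f : chain_map P (shift k X), u_inv e (\pi_(homK _ _) f) = h.
Proof.
have [f fE] := proj_comparison_ex (shift_homology_inv X e \co h \co pr_iso P)
  (@pr_proj _ _ P) (@pr_neg _ _ P) homology_shift_pos_zero.
exists f; rewrite /u_inv homologyK_pi fE !cmpA shift_homologyK cmp1m.
by rewrite -cmpA iso_invK cmpm1.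
Qed.

End U.

Section V.
Variables (Y : complex C) (B : C) (I : inj_resolution B) (l : int).
Hypothesis Y0 : forall m, m < l -> is_zero (homology Y m).

Lemma homology_shift_neg_zero m : m < 0 -> is_zero (homology (shift (- l) Y) m).
Proof.
move=> m0; apply: homology_shift_zero erefl _; apply: Y0.
by rewrite opprK gtrDr.
Qed.

Lemma v_inv_inj : injective (v_inv (Y := Y) (I := I) (l := l)).
Proof.
move=> a b; have [f ->] := homK_piP a; have [g ->] := homK_piP b.
rewrite /v_inv !homologyK_pi -!cmpA => /(@iso_cmpl_inj _ _ _ (iso_sym _)).
move=> /(congr1 (fun t => t \co shift_homology Y (sub0NK l))).
rewrite -!cmpA shift_homology_invK !cmpm1 => fg; apply/homKP.
exact: inj_comparison_unique (@ir_inj _ _ I) (@ir_pos _ _ I)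
  homology_shift_neg_zero fg.
Qed.

Lemma v_inv_surj h :
  exists f : chain_map (shift (- l) Y) I, v_inv (\pi_(homK _ _) f) = h.
Proof.
have [f fE] := inj_comparison_ex
  (ir_iso I \co h \co shift_homology Y (sub0NK l))
  (@ir_inj _ _ I) (@ir_pos _ _ I) homology_shift_neg_zero.
exists f; rewrite /v_inv homologyK_pi fE -!cmpA shift_homologyK cmpm1.
by rewrite cmpA iso_homK cmp1m.
Qed.

(** [v_map] is a chosen preimage; injectivity of [v_inv] replaces it by any preimage at hand. *)
Lemma v_map_pi (f : chain_map (shift (- l) Y) I) h :
  v_inv (\pi_(homK _ _) f) = h -> v_map I h = \pi_(homK _ _) f.
Proof.
move=> fh; apply: v_inv_inj; rewrite fh.
exact: (@xgetPex _ _ [set b | v_inv b = h] (ex_intro _ _ fh)).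
Qed.

End V.

Lemma resolution_pos_zero (A : C) (P : proj_resolution A) (m : int) :
  0 < m -> is_zero (homology P m).
Proof. by move=> m0; apply: pr_exact => m00; rewrite m00 in m0. Qed.

Lemma resolution_neg_zero (B : C) (I : inj_resolution B) (m : int) :
  m < 0 -> is_zero (homology I m).
Proof. by move=> m0; apply: ir_exact => m00; rewrite m00 in m0. Qed.

(** The condition that defines [proj_lift], imposed on a representative instead of a homotopy
    class. *)
Definition proj_lifts (A A' : C) (P : proj_resolution A)
    (P' : proj_resolution A') (f : hom A A') (a : chain_map P P') :=
  pr_iso P' \co homology_map (a 0) = f \co pr_iso P.

Definition inj_lifts (B B' : C) (I : inj_resolution B) (I' : inj_resolution B')
    (f : hom B B') (b : chain_map I I') :=
  homology_map (b 0) \co ir_iso I = ir_iso I' \co f.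

Lemma proj_lifts_ex (A A' : C) (P : proj_resolution A) (P' : proj_resolution A')
  (f : hom A A') : exists a : chain_map P P', proj_lifts f a.
Proof.
have [a aE] := proj_comparison_ex (iso_inv (pr_iso P') \co f \co pr_iso P)
  (@pr_proj _ _ P) (@pr_neg _ _ P) (resolution_pos_zero P').
by exists a; rewrite /proj_lifts aE !cmpA iso_invK cmp1m.
Qed.

Lemma inj_lifts_ex (B B' : C) (I : inj_resolution B) (I' : inj_resolution B')
  (f : hom B B') : exists b : chain_map I I', inj_lifts f b.
Proof.
have [b bE] := inj_comparison_ex (ir_iso I' \co f \co iso_inv (ir_iso I))
  (@ir_inj _ _ I') (@ir_pos _ _ I') (resolution_neg_zero I).
by exists b; rewrite /inj_lifts bE -!cmpA iso_homK cmpm1.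
Qed.

Lemma proj_lift_pi (A A' : C) (P : proj_resolution A) (P' : proj_resolution A')
    (f : hom A A') (a : chain_map P P') :
  proj_lifts f a -> proj_lift P P' f = \pi_(homK _ _) a.
Proof.
move=> af; have : pr_iso P' \co homologyK 0 (proj_lift P P' f) = f \co pr_iso P.
  apply: (@xgetPex _ _ [set a | pr_iso P' \co homologyK 0 a = f \co pr_iso P]).
  by exists (\pi_(homK _ _) a); rewrite /= homologyK_pi.
have [b ->] := homK_piP (proj_lift P P' f); rewrite homologyK_pi -af.
move=> /iso_cmpl_inj ab; apply/homKP.
exact: proj_comparison_unique (@pr_proj _ _ P) (@pr_neg _ _ P)
  (resolution_pos_zero P') ab.
Qed.

Lemma inj_lift_pi (B B' : C) (I : inj_resolution B) (I' : inj_resolution B')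
    (f : hom B B') (b : chain_map I I') :
  inj_lifts f b -> inj_lift I I' f = \pi_(homK _ _) b.
Proof.
move=> bf; have : homologyK 0 (inj_lift I I' f) \co ir_iso I = ir_iso I' \co f.
  apply: (@xgetPex _ _ [set b | homologyK 0 b \co ir_iso I = ir_iso I' \co f]).
  by exists (\pi_(homK _ _) b); rewrite /= homologyK_pi.
have [a ->] := homK_piP (inj_lift I I' f); rewrite homologyK_pi -bf.
move=> /iso_cmpr_inj ab; apply/homKP.
exact: inj_comparison_unique (@ir_inj _ _ I') (@ir_pos _ _ I')
  (resolution_neg_zero I) ab.
Qed.

Lemma id_chain_subproof X i j :
  diff X i j \co idm (X i) = idm (X j) \co diff X i j.
Proof. by rewrite cmpm1 cmp1m. Qed.

Definition id_chain X : chain_map X X := ChainMap (@id_chain_subproof X).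

Lemma homology_map_id X n : homology_map (id_chain X n) = idm (homology X n).
Proof. by apply: homology_mapE; apply: induces_id. Qed.

End CanonicalMaps.

Section DerivedFunctors.
Variables (A B : abelian).

Lemma left_derivedE (F : additive_functor A B)
    (P : forall X : A, proj_resolution X) i (X Y : A) (f : hom X Y)
    (a : chain_map (P X) (P Y)) :
  proj_lifts f a ->
  fmap (left_derived F P i) f = homology_map (map_chain F a i).
Proof. by move=> /proj_lift_pi /= ->; rewrite mapK_pi homologyK_pi. Qed.

Lemma right_derivedE (G : additive_functor B A)
    (I : forall Y : B, inj_resolution Y) i (X Y : B) (f : hom X Y)
    (b : chain_map (I X) (I Y)) :
  inj_lifts f b ->
  fmap (right_derived G I i) f = homology_map (map_chain G b (- i)).
Proof. by move=> /inj_lift_pi /= ->; rewrite mapK_pi homologyK_pi. Qed.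

(** Identities lift identities, composites of lifts lift composites, and any lift computes the
    derived functor. *)
Lemma left_derived_functor (F : additive_functor A B)
  (P : forall X : A, proj_resolution X) i : is_functor (left_derived F P i).
Proof.
split=> [X|X Y Z g f].
  rewrite (left_derivedE F i (a := id_chain (P X))); last first.
    by rewrite /proj_lifts homology_map_id cmpm1 cmp1m.
  apply: homology_mapE; rewrite /= (fmap_id (functorP F)); exact: induces_id.
have [a aE] := proj_lifts_ex (P X) (P Y) f.
have [b bE] := proj_lifts_ex (P Y) (P Z) g.
rewrite (left_derivedE F i aE) (left_derivedE F i bE).
rewrite (left_derivedE F i (a := cmp_chain b a)); last first.
  by rewrite /proj_lifts homology_map_cmp cmpA bE -!cmpA aE.
by rewrite -homology_map_cmp /= (fmap_cmp (functorP F)).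
Qed.

Lemma right_derived_functor (G : additive_functor B A)
  (I : forall Y : B, inj_resolution Y) i : is_functor (right_derived G I i).
Proof.
split=> [X|X Y Z g f].
  rewrite (right_derivedE G i (b := id_chain (I X))); last first.
    by rewrite /inj_lifts homology_map_id cmpm1 cmp1m.
  apply: homology_mapE; rewrite /= (fmap_id (functorP G)); exact: induces_id.
have [a aE] := inj_lifts_ex (I X) (I Y) f.
have [b bE] := inj_lifts_ex (I Y) (I Z) g.
rewrite (right_derivedE G i aE) (right_derivedE G i bE).
rewrite (right_derivedE G i (b := cmp_chain b a)); last first.
  by rewrite /inj_lifts homology_map_cmp -cmpA aE !cmpA bE.
by rewrite -homology_map_cmp /= (fmap_cmp (functorP G)).
Qed.

End DerivedFunctors.

(** * The natural bijection h *)

Lemma exprzN1N (l : int) : (-1) ^ (- l) = (-1) ^ l :> int.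
Proof. by rewrite -exprz_inv invrN1. Qed.

Lemma eq_hom_shift (C : preadditive) (X : complex C) k i j (e : i = j) :
  eq_hom (shift k X) e = eq_hom X (congr1 (fun n => n - k) e)
    :> hom (X (i - k)) (X (j - k)).
Proof. by case: j / e. Qed.

Section AdjunctionShift.
Variables (A B : abelian) (F : functor A B) (G : functor B A).
Variable FG : adjunction F G.
Variables (l : int) (X : complex A) (W : complex B).

Let F' := left_adjoint FG.
Let G' := right_adjoint FG.

Lemma adj_inv_natr (U : A) (V V' : B) (g : hom V V') (f : hom U (G V)) :
  adj_inv FG (fmap G g \co f) = g \co adj_inv FG f.
Proof. by apply: (can_inj (adjK FG)); rewrite adj_natr !adj_invK. Qed.

Lemma adjB (U : A) (V : B) (f g : hom (F U) V) :
  adj FG (f - g) = adj FG f - adj FG g.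
Proof. by apply/eqP; rewrite eq_sym subr_eq -adjD subrK. Qed.

Lemma fmap_eq_hom (C D : preadditive) (H : additive_functor C D)
    (U : complex C) i j (e : i = j) :
  fmap H (eq_hom U e) = eq_hom (map_complex H U) e.
Proof. by case: j / e; rewrite /eq_hom /= (fmap_id (functorP H)). Qed.

Lemma subNKB (n : int) : n - - l - l = n.
Proof. by rewrite opprK addrK. Qed.

(* The passage from [f1] to [f3] in [h_map], on representatives. *)
Definition adj_shift (b : chain_map (shift (- l) (map_complex F' X)) W) :
    chain_map X (shift l (map_complex G' W)) :=
  cmp_chain (map_shift FG l W)
    (adj_chain
      (cmp_chain (shift_chain l b) (shift_shift l (map_complex F' X)))).

Lemma adj_shiftE b n : adj_shift b n =
  adj FG (b (n - l) \co eq_hom (map_complex F' X) (shift_shift_deg l n)).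
Proof. exact: cmp1m. Qed.

Lemma adj_shift_surj (c : chain_map X (shift l (map_complex G' W))) :
  exists b, forall n, adj_shift b n = c n.
Proof.
(* Transposing [c] in degree m + l ends in degree m + l - l of [W]; the cast returns to degree m. *)
pose b m : hom (F (X (m - - l))) (W m) :=
  eq_hom W (subNKB m) \co adj_inv FG (c (m - - l)).
have bd i j : diff W i j \co b i =
    b j \co diff (shift (- l) (map_complex F' X)) i j.
  (* Multiplying the square of [c] by the sign moves it from the target differential to the source
     one, as the shift by -l requires. *)
  have := congr1 (fun t => t *~ (-1) ^ l) (cmap_diff c (i - - l) (j - - l)).
  rewrite /= cmpMzl signrzK => /(congr1 (adj_inv FG)).
  rewrite (additive_mulrz (@adj_invD _ _ _ _ FG _ _)).
  rewrite [in RHS]adj_inv_natl => cd0.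
  have cd := etrans (esym (adj_inv_natr _ _)) cd0.
  rewrite exprzN1N cmpMzr /b cmpA (eq_hom_diff _ (subNKB i) (subNKB j)).
  by rewrite -!cmpA cd cmpMzr.
pose b' := @ChainMap _ (shift (- l) (map_complex F' X)) W _ bd.
exists b' => n; rewrite adj_shiftE /= /b -cmpA.
rewrite -(fmap_eq_hom F') -adj_inv_natl (eq_hom_family c) adj_natr adj_invK.
rewrite eq_hom_shift -(fmap_eq_hom G') cmpA.
(* The two remaining casts compose to a cast along a loop. *)
rewrite (_ : fmap G _ \co _ = idm _) ?cmp1m //.
rewrite -[LHS](fmap_cmp (functorP G)) eq_hom_cmp eq_hom_id.
exact: fmap_id (functorP G) _.
Qed.

Lemma adj_shift_inj b b' :
  homotopic (adj_shift b) (adj_shift b') -> homotopic b b'.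
Proof.
move=> [s sE].
(* The homotopy equation is transposed, with free [p] and [q] because it is used at degrees such as
   [m + 1 - - l]. *)
have {}sE n p q : p = n + 1 -> q = n - 1 ->
    b (n - l) \co eq_hom (map_complex F' X) (shift_shift_deg l n) -
    b' (n - l) \co eq_hom (map_complex F' X) (shift_shift_deg l n) =
    (diff W (p - l) (n - l) \co adj_inv FG (s n p)) *~ (-1) ^ l +
    adj_inv FG (s q n) \co fmap F (diff X n q).
  move=> -> ->; have := sE n; rewrite !adj_shiftE -adjB /= cmpMzl.
  move/(congr1 (adj_inv FG)); rewrite adjK => ->.
  rewrite adj_invD (additive_mulrz (@adj_invD _ _ _ _ FG _ _)).
  by congr (_ *~ _ + _); [apply: adj_inv_natr|apply: adj_inv_natl].
(* The factor (-1)^l accounts for the sign in the first term of [sE], and cancels the sign of the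
   shift by -l in the second. *)
exists (fun i j => eq_hom W (subNKB j) \co
   adj_inv FG (s (i - - l) (j - - l)) *~ (-1) ^ l) => m.
(* Each component is conjugated by casts into degree m + l, where [sE] applies. *)
have bE (c : chain_map (shift (- l) (map_complex F' X)) W) :
    c m = eq_hom W (subNKB m) \co
      (c (m - - l - l) \co
       eq_hom (map_complex F' X) (shift_shift_deg l (m - - l))).
  rewrite (_ : eq_hom _ (shift_shift_deg l (m - - l)) =
    eq_hom (shift (- l) (map_complex F' X)) (esym (subNKB m))).
    by rewrite (eq_hom_family c) cmpA eq_hom_cmp eq_hom_id cmp1m.
  by rewrite eq_hom_shift; congr eq_hom; apply: eq_irrelevance.
rewrite !bE -cmpBr (sE _ (m + 1 - - l) (m - 1 - - l)) 1?addrAC // cmpDr.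
congr (_ + _).
  by rewrite !cmpMzr !cmpA (eq_hom_diff _ (subNKB (m + 1)) (subNKB m)).
by rewrite /= exprzN1N cmpMzl cmpMzr signrzK cmpA.
Qed.

End AdjunctionShift.

Section HMap.
Variables (A B : abelian) (F : functor A B) (G : functor B A).
Variable FG : adjunction F G.
Variable P : forall X : A, proj_resolution X.
Variable I : forall Y : B, inj_resolution Y.
Variable l : int.

Let LF := left_derived (left_adjoint FG) P.
Let RG := right_derived (right_adjoint FG) I.
Let LF_acyclic X := forall i, i <> l -> is_zero (LF i X).
Let RG_acyclic Y := forall i, i <> l -> is_zero (RG i Y).

Lemma LF_acyclic_below X : LF_acyclic X ->
  forall m, m < l -> is_zero (homology (map_complex (left_adjoint FG) (P X)) m).
Proof. by move=> X0 m ml; apply: X0 => ml'; rewrite ml' ltxx in ml. Qed.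

Lemma RG_acyclic_above Y : RG_acyclic Y ->
  forall m, - l < m ->
  is_zero (homology (map_complex (right_adjoint FG) (I Y)) m).
Proof.
move=> Y0 m lm; rewrite -[m]opprK; apply: Y0 => ml.
by rewrite -[m]opprK ml ltxx in lm.
Qed.

(** Evaluates [h_map] on representatives, with no choice of preimage left. *)
Lemma h_mapE X Y (f : hom (LF l X) Y)
    (b : chain_map (shift (- l) (map_complex (left_adjoint FG) (P X))) (I Y)) :
  LF_acyclic X -> v_inv (\pi_(homK _ _) b) = f ->
  h_map I f = u_inv (sub0r l) (\pi_(homK _ _) (adj_shift b)).
Proof.
move=> /LF_acyclic_below X0 /(v_map_pi X0) bf.
by rewrite /h_map bf shiftK_pi cmpK_pi adj_homK_pi cmpK_pi.
Qed.

Lemma h_map_inj X Y : LF_acyclic X -> RG_acyclic Y ->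
  injective (@h_map _ _ _ _ FG P I l X Y).
Proof.
move=> X0 Y0 f g.
have [a af] := v_inv_surj (I Y) (LF_acyclic_below X0) f.
have [b bg] := v_inv_surj (I Y) (LF_acyclic_below X0) g.
rewrite (h_mapE X0 af) (h_mapE X0 bg) => /(u_inv_inj (RG_acyclic_above Y0)).
by move=> /homKP/adj_shift_inj/homKP ab; rewrite -af -bg ab.
Qed.

Lemma h_map_surj X Y (g : hom X (RG l Y)) : LF_acyclic X -> RG_acyclic Y ->
  exists f : hom (LF l X) Y, h_map I f = g.
Proof.
move=> X0 Y0; have [c <-] := u_inv_surj (P X) (sub0r l) (RG_acyclic_above Y0) g.
have [b bc] := adj_shift_surj c.
exists (v_inv (\pi_(homK _ _) b)).
by rewrite (h_mapE X0 erefl) /u_inv !homologyK_pi bc.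
Qed.

Lemma h_map_nat X X' Y Y' (a : hom X' X) (f : hom (LF l X) Y) (g : hom Y Y') :
  LF_acyclic X -> LF_acyclic X' ->
  h_map I (g \co f \co fmap (LF l) a) = fmap (RG l) g \co h_map I f \co a.
Proof.
move=> X0 X0'; have [al alE] := proj_lifts_ex (P X') (P X) a.
have [be beE] := inj_lifts_ex (I Y) (I Y') g.
have [b bf] := v_inv_surj (I Y) (LF_acyclic_below X0) f.
rewrite (left_derivedE (left_adjoint FG) l alE).
rewrite (right_derivedE (right_adjoint FG) l beE).
(* A representative for the composite on the left, built from lifts of [a] and [g]. *)
pose b' := cmp_chain be
  (cmp_chain b (shift_chain (- l) (map_chain (left_adjoint FG) al))).
rewrite (h_mapE X0 bf) (h_mapE (b := b') X0'); last first.
  rewrite -bf /v_inv !homologyK_pi !homology_map_cmp -!cmpA.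
  rewrite shift_homology_inv_nat !cmpA.
  do 3!congr (_ \co _); apply: (@iso_cmpr_inj _ _ _ _ (ir_iso (I Y))).
  by rewrite -!cmpA iso_homK cmpm1 beE cmpA iso_homK cmp1m.
rewrite /u_inv !homologyK_pi.
(* Naturality of the adjunction, compared in degree 0 only, which is all that H_0 sees. *)
have -> : adj_shift b' 0 =
    cmp_chain (shift_chain l (map_chain (right_adjoint FG) be))
      (cmp_chain (adj_shift b) al) 0.
  rewrite adj_shiftE [RHS]/= cmp1m -adj_natl -adj_natr /= -!cmpA.
  congr (adj FG (_ \co (_ \co _))).
  exact: (eq_hom_family (map_chain (left_adjoint FG) al)).
rewrite !homology_map_cmp !cmpA shift_homology_nat -!cmpA; do 4!congr (_ \co _).
apply: (@iso_cmpl_inj _ _ _ _ (pr_iso (P X))).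
by rewrite cmpA alE cmpA iso_invK cmp1m -cmpA iso_invK cmpm1.
Qed.


Lemma h_map_natl X X' Y (a : hom X' X) (f : hom (LF l X) Y) :
  LF_acyclic X -> LF_acyclic X' ->
  h_map I (f \co fmap (LF l) a) = h_map I f \co a.
Proof.
move=> X0 X0'; rewrite -[in LHS](cmp1m f) h_map_nat //.
by rewrite (fmap_id (right_derived_functor _ _ _)) cmp1m.
Qed.

Lemma h_map_natr X Y Y' (f : hom (LF l X) Y) (g : hom Y Y') :
  LF_acyclic X -> h_map I (g \co f) = fmap (RG l) g \co h_map I f.
Proof.
move=> X0; rewrite -(cmpm1 (g \co f)) -(fmap_id (left_derived_functor _ _ _)).
by rewrite h_map_nat // cmpm1.
Qed.

(** * Unit, counit, and fixed objects *)

Lemma h_map_eps Y : RG_acyclic Y -> LF_acyclic (RG l Y) ->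
  h_map I (eps FG P I l Y) = idm (RG l Y).
Proof.
(* Surjectivity of [h_map] ensures that [eps] is a genuine preimage and not the default 0. *)
move=> Y0 RY0; apply: (@xgetPex _ 0 [set f | h_map I f = idm (RG l Y)]).
exact: h_map_surj.
Qed.

(** Both sides are the image under [h_map] of [fmap (LF l) f]. *)
Lemma eta_nat X X' (f : hom X X') : LF_acyclic X -> LF_acyclic X' ->
  eta FG P I l X' \co f = fmap (RG l) (fmap (LF l) f) \co eta FG P I l X.
Proof.
by move=> X0 X0'; rewrite -h_map_natl // -h_map_natr // cmp1m cmpm1.
Qed.

(** [h_map] sends both sides to [fmap (RG l) g]. *)
Lemma eps_nat Y Y' (g : hom Y Y') :
  RG_acyclic Y -> LF_acyclic (RG l Y) ->
  RG_acyclic Y' -> LF_acyclic (RG l Y') ->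
  g \co eps FG P I l Y = eps FG P I l Y' \co fmap (LF l) (fmap (RG l) g).
Proof.
move=> Y0 RY0 Y0' RY0'; apply: h_map_inj => //.
by rewrite h_map_natr // h_map_natl // !h_map_eps // cmpm1 cmp1m.
Qed.

(** [h_map] sends both sides to [eta] at [X]. *)
Lemma eps_eta X : LF_acyclic X -> RG_acyclic (LF l X) ->
  LF_acyclic (RG l (LF l X)) ->
  eps FG P I l (LF l X) \co fmap (LF l) (eta FG P I l X) = idm (LF l X).
Proof.
move=> X0 LX0 RLX0; apply: h_map_inj => //.
by rewrite h_map_natl // h_map_eps // cmp1m.
Qed.

Lemma eta_eps Y : RG_acyclic Y -> LF_acyclic (RG l Y) ->
  fmap (RG l) (eps FG P I l Y) \co eta FG P I l (RG l Y) = idm (RG l Y).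
Proof. by move=> Y0 RY0; rewrite -h_map_natr // cmpm1 h_map_eps. Qed.

Lemma fixed_LF X : fixed FG P I l X -> cofixed FG P I l (LF l X).
Proof.
move=> [X0 LX0 eta_iso].
have RLX0 : LF_acyclic (RG l (LF l X)).
  (* Every derived functor, not only the one of degree [l], keeps [eta] invertible. *)
  move=> i il; apply: is_zero_target (X0 i il).
  exact: fmap_is_iso (left_derived_functor _ _ _) eta_iso.
split=> //; apply: is_iso_left_inverse (eps_eta X0 LX0 RLX0).
exact: fmap_is_iso (left_derived_functor _ _ _) eta_iso.
Qed.

Lemma cofixed_RG Y : cofixed FG P I l Y -> fixed FG P I l (RG l Y).
Proof.
move=> [Y0 RY0 eps_iso]; split=> //.
  move=> i il; apply: is_zero_source (Y0 i il).
  exact: fmap_is_iso (right_derived_functor _ _ _) eps_iso.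
apply: is_iso_right_inverse (eta_eps Y0 RY0).
exact: fmap_is_iso (right_derived_functor _ _ _) eps_iso.
Qed.

End HMap.

(** * The adjoint equivalence *)

Theorem theorem3p8 (A B : abelian)
    (hA : enough_projectives A) (hB : enough_injectives B)
    (F : functor A B) (G : functor B A) (FG : adjunction F G)
    (P : forall X : A, proj_resolution X)
    (I : forall Y : B, inj_resolution Y) (l : int) :
  let LF := left_derived (left_adjoint FG) P l in
  let RG := right_derived (right_adjoint FG) I l in
  exists (LF_cofixed : forall X, fixed FG P I l X -> cofixed FG P I l (LF X))
         (RG_fixed : forall Y, cofixed FG P I l Y -> fixed FG P I l (RG Y))
         (LF_functor : is_functor (restrict LF_cofixed))
         (RG_functor : is_functor (restrict RG_fixed)),
    adjoint_equivalence (Functor LF_functor) (Functor RG_functor).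
Proof.
move=> LF RG.
exists (@fixed_LF _ _ _ _ FG P I l), (@cofixed_RG _ _ _ _ FG P I l).
have LF_functor := left_derived_functor (left_adjoint FG) P l.
have RG_functor := right_derived_functor (right_adjoint FG) I l.
(* Composition in a full subcategory is the ambient one, so functoriality is inherited. *)
unshelve eexists.
  by split=> [X|X Y Z g f];
    [apply: (fmap_id LF_functor)|apply: (fmap_cmp LF_functor)].
unshelve eexists.
  by split=> [X|X Y Z g f];
    [apply: (fmap_id RG_functor)|apply: (fmap_cmp RG_functor)].
exists (fun X => eta FG P I l (sval X)), (fun Y => eps FG P I l (sval Y)).
split.
- by move=> [X [X0 ? ?]] [X' [X0' ? ?]] f; apply: eta_nat.
- by move=> [Y [Y0 RY0 ?]] [Y' [Y0' RY0' ?]] g; apply: eps_nat.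
- by split=> [[X [? ? ?]]|[Y [? ? ?]]].
(* The vanishing on [RG (LF X)] that [eps_eta] requires comes from [LF X] being cofixed. *)
- move=> [X fX]; have [X0 LX0 _] := fX; have [_ RLX0 _] := fixed_LF fX.
  exact: eps_eta.
- by move=> [Y [Y0 RY0 ?]]; apply: eta_eps.
Qed.
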